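(* Let $n\ge 2$. The subgroup $K=\mathrm{Aut}(\mathcal T_n)$ is spherical in the topological group $G=\mathrm{Hier}(\mathcal T_n)$, that is: (A) for any irreducible unitary representation of $G$, the subspace of $K$-fixed vectors has dimension $\le 1$; (B) there is a faithful unitary representation of $G$ and a vector $v$ in its space such that the stabilizer of $v$ in $G$ is exactly $K$.
   Context: Fix an integer $n\ge 2$. $\mathcal T_n$ is the infinite tree in which each vertex belongs to exactly $n+1$ edges. $\mathrm{Aut}(\mathcal T_n)$ is the group of all automorphisms of $\mathcal T_n$, with the topology in which stabilizers of finite subtrees are open; it is a totally disconnected locally compact group. A way in $\mathcal T_n$ is a sequence of vertices $a_1,a_2,\dots$ with $a_i,a_{i+1}$ adjacent and $a_{i+2}\ne a_i$ for all $i$; two ways $(a_i)$, $(b_j)$ are equivalent if for some $k$ one has $a_i=b_{i+k}$ for all large $i$. The boundary $\mathrm{Abs}(\mathcal T_n)$ is the set of equivalence classes of ways. Cutting $\mathcal T_n$ at the midpoint of an edge gives two pieces called branches; the set of boundary points represented by ways lying in a branch $U$ is called a ball $\mathrm{Ba}[U]$. The topology on $\mathrm{Abs}(\mathcal T_n)$ is defined by declaring balls to be clopen; it is a totally disconnected compact set. $\mathrm{Aut}(\mathcal T_n)$ acts on it by homeomorphisms. A spheromorphism of $\mathcal T_n$ is a homeomorphism $q$ of $\mathrm{Abs}(\mathcal T_n)$ such that each $y\in\mathrm{Abs}(\mathcal T_n)$ has a neighborhood on which $q$ coincides with (the action of) some $r_y\in\mathrm{Aut}(\mathcal T_n)$.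 $\mathrm{Hier}(\mathcal T_n)$ is the group of all spheromorphisms, with the group topology in which $\mathrm{Aut}(\mathcal T_n)$ (with its own topology) is an open and closed subgroup; the countable space $\mathrm{Hier}(\mathcal T_n)/\mathrm{Aut}(\mathcal T_n)$ is discrete. Unitary representations of topological groups are assumed (strongly) continuous. *)

(* Defs.v *)
From HB Require Import structures.
From mathcomp Require Import all_boot all_order all_algebra.
From mathcomp Require Import monoid generic_quotient.
From mathcomp Require Import boolp classical_sets functions cardinality.
From mathcomp Require Import reals topology normedtype.
From mathcomp Require Import complex.

Set Implicit Arguments.
Unset Strict Implicit.
Unset Printing Implicit Defensive.

Import Order.TTheory GRing.Theory Num.Theory.

Local Open Scope classical_set_scope.
Local Open Scope quotient_scope.
Local Open Scope card_scope.

Record regular_tree (n : nat) := RegularTree {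
  vertex :> choiceType;
  adj : rel vertex;
  adj_sym : symmetric adj;
  adj_irr : irreflexive adj;
  tree_nonempty : inhabited vertex;
  tree_connected : forall x y, exists2 p, path adj x p & last x p = y;
  tree_acyclic : forall c, ucycle adj c -> (size c <= 2)%N;
  tree_regular : forall x, [set y | adj x y] #= `I_n.+1
}.

Definition subtree n (T : regular_tree n) (F : set T) : Prop :=
  forall x y, F x -> F y ->
    exists p, [/\ path (@adj n T) x p, last x p = y & forall z, z \in p -> F z].

Definition inv_fun (T : choiceType) (f : T -> T) (y : T) : T :=
  xget y [set x | f x = y].

Lemma inv_funK (T : choiceType) (f : T -> T) :
  bijective f -> cancel f (inv_fun f).
Proof.
move=> bf x; rewrite /inv_fun; case: xgetP => [z _ /(bij_inj bf)//|].
by move=> /(_ x)/(_ erefl).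
Qed.

Lemma inv_funVK (T : choiceType) (f : T -> T) :
  bijective f -> cancel (inv_fun f) f.
Proof. by move=> bf; exact/(bij_can_sym bf)/inv_funK. Qed.

Lemma inv_fun_bij (T : choiceType) (f : T -> T) :
  bijective f -> bijective (inv_fun f).
Proof. by move=> bf; exists f; [exact: inv_funVK|exact: inv_funK]. Qed.

#[short(type="preTopologicalGroupType")]
HB.structure Definition PreTopologicalGroup := {G of Topological G & Group G}.

Section Automorphisms.
Context {n : nat} (T : regular_tree n).

Definition automorphism : set (T -> T) :=
  [set f : T -> T | bijective f /\ forall x y, adj (f x) (f y) = adj x y].

Definition aut : Type := set_type automorphism.
HB.instance Definition _ := Choice.on aut.

Definition aut_fun (g : aut) : T -> T := val g.
Coercion aut_fun : aut >-> Funclass.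

Lemma autP (g : aut) : automorphism g.
Proof. exact: set_mem (valP g). Qed.

Lemma aut_eq (g h : aut) : g =1 h -> g = h.
Proof. by move=> gh; apply/val_inj/funext. Qed.

Lemma aut1_subproof : automorphism id.
Proof. by split=> //; exists id. Qed.

Lemma autM_subproof (g h : aut) : automorphism (g \o h).
Proof.
have [[bg ag] [bh ah]] := (autP g, autP h).
by split=> [|x y /=]; [exact: bij_comp|rewrite ag ah].
Qed.

Lemma autV_subproof (g : aut) : automorphism (inv_fun g).
Proof.
have [bg ag] := autP g; split=> [|x y]; first exact: inv_fun_bij.
by rewrite -ag !inv_funVK.
Qed.

Definition aut1 : aut := SigSub (mem_set aut1_subproof).
Definition autM (g h : aut) : aut := SigSub (mem_set (autM_subproof g h)).
Definition autV (g : aut) : aut := SigSub (mem_set (autV_subproof g)).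

Let autA : associative autM. Proof. by move=> f g h; exact: aut_eq. Qed.
Let aut1g : left_id aut1 autM. Proof. by move=> f; exact: aut_eq. Qed.
Let autg1 : right_id aut1 autM. Proof. by move=> f; exact: aut_eq. Qed.
Let autVg : left_inverse aut1 autV autM.
Proof. by move=> f; apply: aut_eq => x; exact: inv_funK (autP f).1 x. Qed.
Let autgV : right_inverse aut1 autV autM.
Proof. by move=> f; apply: aut_eq => x; exact: inv_funVK (autP f).1 x. Qed.

HB.instance Definition _ := isGroup.Build aut autA aut1g autg1 autVg autgV.

Definition stabilizer (F : set T) : set aut :=
  [set g | forall x, F x -> g x = x].

(* Pointwise stabilizers are finite intersections of stabilizers of vertices,
   so the setwise stabilizers of finite subtrees generate the same topology. *)
Definition stabilizer_coset : set (set aut) :=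
  [set U | exists (g : aut) (F : set T),
     [/\ finite_set F, subtree F & U = [set (g * s)%g | s in stabilizer F]]].

HB.instance Definition _ :=
  isSubBaseTopological.Build aut stabilizer_coset idfun.

End Automorphisms.

Section Boundary.
Context {n : nat} (T : regular_tree n).

Definition is_way : set (nat -> T) :=
  [set a | (forall i, adj (a i) (a i.+1)) /\ (forall i, a i.+2 <> a i)].

Definition way : Type := set_type is_way.
HB.instance Definition _ := Choice.on way.

Definition way_fun (a : way) : nat -> T := val a.
Coercion way_fun : way >-> Funclass.

Lemma wayP (a : way) : is_way a. Proof. exact: set_mem (valP a). Qed.

(* The shift [l - k] between equivalent ways may have either sign. *)
Definition way_equiv (a b : way) : Prop :=
  exists k l, \forall i \near \oo, a (i + k)%N = b (i + l)%N.

Lemma way_equivP (a b : way) :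
  way_equiv a b <-> exists k l, forall i, a (i + k)%N = b (i + l)%N.
Proof.
split=> [[k [l [N _ ab]]]|[k [l ab]]]; last by exists k, l; exact: nearW.
exists (N + k)%N, (N + l)%N => i.
by rewrite !addnA; apply: ab; rewrite /= leq_addl.
Qed.

Definition way_equivb (a b : way) : bool := `[< way_equiv a b >].

Let way_equivb_refl : reflexive way_equivb.
Proof. by move=> a; apply/asboolP/way_equivP; exists 0%N, 0%N. Qed.

Let way_equivb_sym : symmetric way_equivb.
Proof.
by move=> a b; apply/asboolP/asboolP => /way_equivP[k [l ab]];
  apply/way_equivP; exists l, k.
Qed.

Let way_equivb_trans : transitive way_equivb.
Proof.
move=> b a c /asboolP/way_equivP[k [l ab]] /asboolP/way_equivP[k' [l' bc]].
apply/asboolP/way_equivP; exists (k' + k)%N, (l + l')%N => i.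
rewrite [LHS](_ : _ = a (i + k' + k)%N) ?addnA//.
by rewrite ab -addnA (addnC k') addnA bc.
Qed.

Canonical way_equiv_rel :=
  EquivRel way_equivb way_equivb_refl way_equivb_sym way_equivb_trans.

Definition boundary : Type := {eq_quot way_equiv_rel}.
HB.instance Definition _ := Choice.on boundary.

Definition endpoint (a : way) : boundary := \pi_({eq_quot way_equiv_rel}) a.

Lemma endpointP (a b : way) : endpoint a = endpoint b <-> way_equiv a b.
Proof.
by split=> [/eqquotP/asboolP|ab]; [|apply/eqquotP/asboolP].
Qed.

Lemma endpoint_surj (y : boundary) : exists a, y = endpoint a.
Proof. by exists (repr y); rewrite /endpoint reprK. Qed.

(* The piece containing [y] when the tree is cut at the midpoint of [{x, y}]. *)
Definition cut_adj (x y : T) : rel T :=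
  fun u v => adj u v && ((u, v) \notin [:: (x, y); (y, x)]).

Definition branch (x y : T) : set T :=
  [set z | exists2 p, path (cut_adj x y) y p & last y p = z].

Definition ball (U : set T) : set boundary :=
  [set y | exists2 a : way, y = endpoint a & forall i, U (a i)].

Definition is_ball : set (set boundary) :=
  [set B | exists x y, adj x y /\ B = ball (branch x y)].

HB.instance Definition _ := isSubBaseTopological.Build boundary
  [set B | is_ball B \/ is_ball (~` B)] idfun.

Lemma way_map_subproof (g : aut T) (a : way) : is_way (g \o a).
Proof.
have [[bg ag] [a1 a2]] := (autP g, wayP a).
by split=> i /=; [rewrite ag|move/(bij_inj bg); exact: a2].
Qed.

Definition way_map (g : aut T) (a : way) : way :=
  SigSub (mem_set (way_map_subproof g a)).

Definition boundary_act (g : aut T) (y : boundary) : boundary :=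
  endpoint (way_map g (repr y)).

Lemma boundary_act_endpoint (g : aut T) (a : way) :
  boundary_act g (endpoint a) = endpoint (way_map g a).
Proof.
apply/endpointP; have : way_equiv (repr (endpoint a)) a.
  by apply/endpointP; rewrite /endpoint reprK.
by move=> /way_equivP[k [l e]]; apply/way_equivP; exists k, l => i /=;
  congr (g _); exact: e.
Qed.

Lemma boundary_act1 : boundary_act 1%g =1 id.
Proof.
move=> y; have [a ->] := endpoint_surj y; rewrite boundary_act_endpoint.
by congr endpoint; exact/val_inj.
Qed.

Lemma boundary_actM (g h : aut T) :
  boundary_act (g * h)%g =1 boundary_act g \o boundary_act h.
Proof.
move=> y; have [a ->] := endpoint_surj y; rewrite /= !boundary_act_endpoint.
by congr endpoint; exact/val_inj.
Qed.

End Boundary.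

Section Spheromorphisms.
Context {n : nat} (T : regular_tree n).

Lemma path_aut (g : aut T) (e e' : rel T) :
  (forall u v, e' (g u) (g v) = e u v) ->
  forall x p, path e' (g x) (map g p) = path e x p.
Proof. by move=> ee x p; rewrite path_map; apply: eq_path => u v /=. Qed.

Lemma branch_aut (g : aut T) x y z : branch (g x) (g y) (g z) <-> branch x y z.
Proof.
have [bg ag] := autP g; have gI := bij_inj bg.
have cutE u v : cut_adj (g x) (g y) (g u) (g v) = cut_adj x y u v.
  by rewrite /cut_adj ag !inE !xpair_eqE !(inj_eq gI).
split=> [[p xp lp]|[p xp <-]].
  exists (map (inv_fun g) p); last first.
    by rewrite -[y in last y _](inv_funK bg) last_map lp; exact: inv_funK.
  have gp : map g (map (inv_fun g) p) = p.
    by rewrite -map_comp map_id_in// => u _ /=; exact: inv_funVK.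
  by rewrite -(path_aut cutE) gp.
by exists (map g p); [rewrite (path_aut cutE)|rewrite last_map].
Qed.

Lemma boundary_actK (g : aut T) : cancel (boundary_act g) (boundary_act g^-1%g).
Proof.
by move=> y; rewrite -[LHS](boundary_actM g^-1%g g) mulVg boundary_act1.
Qed.

Lemma boundary_actVK (g : aut T) :
  cancel (boundary_act g^-1%g) (boundary_act g).
Proof. by move=> y; rewrite -[LHS](boundary_actM g) mulgV boundary_act1. Qed.

Lemma ball_act (g : aut T) x y b :
  ball (branch (g x) (g y)) b -> ball (branch x y) (boundary_act g^-1%g b).
Proof.
move=> [a -> ha]; exists (way_map g^-1%g a); first exact: boundary_act_endpoint.
move=> i; apply/(branch_aut g) => /=.
have -> : g (inv_fun g (a i)) = a i by exact: inv_funVK (autP g).1 _.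
exact: ha.
Qed.

Lemma preimage_ball_act (g : aut T) (B : set (boundary T)) :
  is_ball B -> is_ball (boundary_act g @^-1` B).
Proof.
move=> [x [y [xy ->]]]; have [bg ag] := autP g^-1%g.
exists (inv_fun g x), (inv_fun g y); split; first by rewrite ag.
apply/seteqP; split=> b.
  move=> /= h; rewrite -(boundary_actK g b); apply: ball_act.
  by rewrite !inv_funVK //; exact: (autP g).1.
by move=> h; have := @ball_act g^-1%g x y b h; rewrite invgK.
Qed.

Lemma boundary_act_continuous (g : aut T) : continuous (boundary_act g).
Proof.
move=> x A [_ [[D sD <-] [J DJ Jgx] sBA]].
have [E sE eJ] := sD _ DJ; rewrite nbhs_filterE.
apply: (@filterS _ (nbhs x) _ (boundary_act g @^-1` J)).
  by move=> z Jz; apply: sBA; exists J.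
rewrite -eJ preimage_bigcap; apply: filter_bigI => B EB.
have {}sE := set_mem (sE B EB).
have preD : is_ball (boundary_act g @^-1` B)
    \/ is_ball (~` (boundary_act g @^-1` B)).
  by case: sE => h; [left|right; rewrite preimage_setC];
    exact: preimage_ball_act.
have Bx : B (boundary_act g x) by move: Jgx; rewrite -eJ; apply.
exists (boundary_act g @^-1` B); split => //.
exists [set boundary_act g @^-1` B]; last by rewrite bigcup_set1.
by move=> _ ->; exact: (@finI_from1 _ _ _ idfun).
Qed.

Definition spheromorphism : set (boundary T -> boundary T) :=
  [set q : boundary T -> boundary T |
    [/\ bijective q, continuous q, continuous (inv_fun q) &
        forall y : boundary T, exists r : aut T,
          \forall z \near y, q z = boundary_act r z]].

Definition hier : Type := set_type spheromorphism.
HB.instance Definition _ := Choice.on hier.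

Definition hier_fun (q : hier) : boundary T -> boundary T := val q.
Coercion hier_fun : hier >-> Funclass.

Lemma hierP (q : hier) : spheromorphism q.
Proof. exact: set_mem (valP q). Qed.

Lemma hier_eq (p q : hier) : p =1 q -> p = q.
Proof. by move=> pq; apply/val_inj/funext. Qed.

Lemma inv_funE (f g : boundary T -> boundary T) :
  cancel f g -> cancel g f -> inv_fun f = g.
Proof.
move=> fg gf; apply/funext => y; apply: (can_inj fg).
by rewrite gf inv_funVK//; exists g.
Qed.

Lemma boundary_act_spheromorphism (g : aut T) : spheromorphism (boundary_act g).
Proof.
have [gK gVK] := (boundary_actK g, boundary_actVK g).
split; [by exists (boundary_act g^-1%g)|exact: boundary_act_continuous| |].
  by rewrite (inv_funE gK gVK); exact: boundary_act_continuous.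
by move=> y; exists g; exact: (@filterE _ (nbhs y)).
Qed.

Lemma hierM_subproof (p q : hier) : spheromorphism (p \o q).
Proof.
have [[bp cp cVp lp] [bq cq cVq lq]] := (hierP p, hierP q).
split.
- exact: bij_comp.
- by move=> y; apply: continuous_comp; [exact: cq|exact: cp].
- rewrite (@inv_funE _ (inv_fun q \o inv_fun p)).
  + by move=> y; apply: continuous_comp; [exact: cVp|exact: cVq].
  + by move=> y /=; rewrite !inv_funK.
  + by move=> y /=; rewrite !inv_funVK.
- move=> y; have [[s hs] [r hr]] := (lq y, lp (q y)).
  exists (r * s)%g; have := cq y _ hr => /= hr'.
  by apply: filterS2 hs hr' => z qz pz; rewrite boundary_actM /= -qz -pz.
Qed.

Lemma hierV_subproof (q : hier) : spheromorphism (inv_fun q).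
Proof.
have [bq cq cVq lq] := hierP q; have [qK qVK] := (inv_funK bq, inv_funVK bq).
split=> //; first exact: inv_fun_bij.
  by rewrite (inv_funE qVK qK).
move=> y; have [r hr] := lq (inv_fun q y); exists r^-1%g.
apply: (@filterS _ (nbhs y) _ _ _ _ (cVq y _ hr)) => z /=; rewrite qVK => {2}->.
by rewrite boundary_actK.
Qed.

Lemma hier1_subproof : spheromorphism id.
Proof.
have -> : id = boundary_act (1%g : aut T).
  by apply/funext => y; rewrite boundary_act1.
exact: boundary_act_spheromorphism.
Qed.

Definition hier1 : hier := SigSub (mem_set hier1_subproof).
Definition hierM (p q : hier) : hier := SigSub (mem_set (hierM_subproof p q)).
Definition hierV (q : hier) : hier := SigSub (mem_set (hierV_subproof q)).

Let hierA : associative hierM. Proof. by move=> f g h; exact: hier_eq. Qed.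
Let hier1g : left_id hier1 hierM. Proof. by move=> f; exact: hier_eq. Qed.
Let hierg1 : right_id hier1 hierM. Proof. by move=> f; exact: hier_eq. Qed.
Let hierVg : left_inverse hier1 hierV hierM.
Proof.
by move=> f; apply: hier_eq => x; case: (hierP f) => bf *; exact: inv_funK.
Qed.
Let hiergV : right_inverse hier1 hierV hierM.
Proof.
by move=> f; apply: hier_eq => x; case: (hierP f) => bf *; exact: inv_funVK.
Qed.

HB.instance Definition _ :=
  isGroup.Build hier hierA hier1g hierg1 hierVg hiergV.

Definition hier_of_aut (g : aut T) : hier :=
  SigSub (mem_set (boundary_act_spheromorphism g)).

Lemma hier_of_autM : {morph hier_of_aut : g h / (g * h)%g}.
Proof. by move=> g h; apply: hier_eq => y; exact: boundary_actM. Qed.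

Definition Aut_in_Hier : set hier := range hier_of_aut.

(* The group is the disjoint union of the cosets [q * Aut_in_Hier]; each of them
   is declared open and gets the topology of [aut T] by translation. This is the
   only left-invariant topology in which [aut T], with its own topology, is an
   open subgroup. *)
Definition hier_open : set (set hier) :=
  [set U | forall q : hier, open [set k : aut T | U (q * hier_of_aut k)%g]].

Let hier_openT : hier_open setT. Proof. by move=> q; exact: openT. Qed.
Let hier_openI : setI_closed hier_open.
Proof. by move=> U V oU oV q; apply: openI; [exact: oU|exact: oV]. Qed.
Let hier_open_bigU (I : Type) (U : I -> set hier) :
  (forall i, hier_open (U i)) -> hier_open (\bigcup_i U i).
Proof. by move=> oU q; rewrite -[X in open X]/(_ @^-1` (\bigcup_i U i))
  preimage_bigcup; apply: bigcup_open => i _; exact: oU. Qed.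

HB.instance Definition _ :=
  isOpenTopological.Build hier hier_openT hier_openI hier_open_bigU.

Lemma hier_mull_continuous (p : hier) : continuous (fun q : hier => (p * q)%g).
Proof.
apply/continuousP => U oU; rewrite -[open _]/(hier_open _) => q.
have := (oU : hier_open U) (p * q)%g; congr open; apply/funext => k /=.
by rewrite mulgA.
Qed.

Lemma Aut_in_Hier_mul (p : hier) (k : aut T) :
  Aut_in_Hier (p * hier_of_aut k)%g <-> Aut_in_Hier p.
Proof.
split=> [[h _ e]|[h _ <-]]; last by exists (h * k)%g; rewrite ?hier_of_autM.
exists (h * k^-1)%g => //; rewrite hier_of_autM e -mulgA -hier_of_autM mulgV.
by rewrite [X in (_ * X)%g](_ : _ = 1%g) ?mulg1//; apply: hier_eq => y;
  exact: boundary_act1.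
Qed.

Lemma Aut_in_Hier_clopen : clopen Aut_in_Hier.
Proof.
have coset (P : Prop) (A : set (aut T)) : (forall k, A k <-> P) -> open A.
  have [p|p] := pselect P => AP.
    have -> : A = setT by apply/seteqP; split=> // k _; apply/AP.
    exact: openT.
  have -> : A = set0 by apply/seteqP; split=> // k /AP.
  exact: open0.
split; last rewrite -openC; rewrite -[open _]/(hier_open _) => q.
  by apply: (@coset (Aut_in_Hier q)) => k; exact: Aut_in_Hier_mul.
apply: (@coset (~ Aut_in_Hier q)) => k /=.
by split; apply: contra_not => /Aut_in_Hier_mul.
Qed.

End Spheromorphisms.

Arguments Aut_in_Hier {n} T.

Local Open Scope ring_scope.

Record hilbert_space (R : realType) := HilbertSpace {
  hilbert_sort :> completeNormedModType R[i];
  hdot : {dot hilbert_sort for Num.conj};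
  hdot_norm : forall x, hdot x x = `|x| ^+ 2
}.
Arguments hdot {R} h.

Record unitary_rep (R : realType) (G : preTopologicalGroupType)
    (H : hilbert_space R) := UnitaryRep {
  rep :> G -> {linear H -> H};
  rep1 : forall x, rep 1%g x = x;
  repM : forall g h x, rep (g * h)%g x = rep g (rep h x);
  rep_unitary : forall g x y, hdot H (rep g x) (rep g y) = hdot H x y;
  rep_continuous : forall x, continuous (fun g => rep g x)
}.

Section Representations.
Context {R : realType} {G : preTopologicalGroupType} {H : hilbert_space R}.
Variable rho : unitary_rep G H.

Definition irreducible : Prop :=
  (exists x : H, x != 0) /\
  forall W : set H, submod_closed (mem W) -> closed W ->
    (forall g x, W x -> W (rho g x)) -> W = [set 0] \/ W = setT.

Definition fixed_vectors (K : set G) : set H :=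
  [set x | forall k, K k -> rho k x = x].

Definition faithful : Prop := forall g, (forall x, rho g x = x) -> g = 1%g.

Definition vector_stabilizer (x : H) : set G := [set g | rho g x = x].

End Representations.

Definition dim_le1 (R : realType) (H : hilbert_space R) (W : set H) : Prop :=
  exists2 e, W e & forall x, W x -> exists c : R[i], x = c *: e.

(* Main.v *)
From HB Require Import structures.
From mathcomp Require Import all_boot all_order all_algebra.
From mathcomp Require Import fingroup perm monoid finmap.
From mathcomp Require Import boolp classical_sets functions cardinality.
From mathcomp Require Import reals topology normedtype.
From mathcomp Require Import complex.
From mathcomp Require Import lra ring.
Require Import Defs.

(** Write [G] for the group of spheromorphisms and [K] for the automorphisms
    of the tree, acting on its ends.

    Multiplicity at most one.  Let [t] be an automorphism translating an axis
    by one edge, with [x], [t x], [t (t x)] three consecutive vertices of it.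
    By Mautner's phenomenon a vector fixed by [t] is fixed by all automorphisms
    that are trivial on a branch cut along the axis, and these together with
    [t] generate [K] ([aut_generated]): the vectors fixed by [t] are the vectors
    fixed by [K] ([fixed_by_translation]).  So, by von Neumann's mean ergodic
    theorem ([mean_ergodic]), the averages of the powers of [rho(t)] converge
    to the projection [P] on the [K]-fixed vectors.

    The operators [P rho(g) P] commute with each other.  Indeed they only
    depend on the double coset [K g K], and this double coset contains an
    element that is the identity on any prescribed ball ([hier_fixes_ball]).
    Take [g] trivial on the ball ahead of the axis and [h] trivial on the
    complementary ball.  For all [j >= 0] the element [t^j h t^-j] is supported
    in the ball where [g] is trivial, so the two commute
    ([translates_commute]); hence [P rho(g) rho(t^j) rho(h) P] equals
    [P rho(h) rho(t^-j) rho(g) P], and averaging over [j] gives the claim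
    ([spherical_operators]).

    A commuting family of contractions that is stable under adjoints cannot
    act irreducibly on a space of dimension at least two: a self-adjoint [S]
    that is not scalar has an indefinite shift [D], and the ranges of [|D| + D]
    and [|D| - D] are then non-zero, orthogonal and stable under everything that
    commutes with [S] ([commuting_reducible], with [absolute_value] for [|D|]).
    Applied to the operators [P rho(g) P], this gives two non-zero fixed vectors
    with orthogonal orbits, against irreducibility ([irreducible_dim_le1]).

    A faithful representation.  [G] permutes the left cosets [q L], where [L] is
    the pointwise stabilizer in [K] of a finite set of vertices.  The stabilizer
    of such a coset is open, because [L] and [q L q^-1] are commensurate
    ([hier_commensurates]); so [G] acts continuously on the square-summable
    families indexed by the cosets.  The delta function at the coset [K] has
    stabilizer [K], and an element fixing all these stabilizers acts trivially
    on ends ([fixing_stabilizers_trivial]). *)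

Set Implicit Arguments.
Unset Strict Implicit.
Unset Printing Implicit Defensive.

Import Order.TTheory GRing.Theory Num.Theory.
Import numFieldNormedType.Exports.

Local Open Scope classical_set_scope.

Local Notation "\d k" := (hier_of_aut k) (at level 10).

(** * Reduced walks and branches of the tree *)

Section ReducedWalks.
Context {n : nat} {T : regular_tree n}.
Implicit Types (x y z w : T) (p q : seq T).

(** Walks that continue the oriented edge [(x, y)] without backtracking.  With
    the previous vertex as an argument, cutting off the first step is a plain
    recursion. *)
Fixpoint nbt x y p : bool :=
  if p is z :: q then [&& adj y z, z != x & nbt y z q] else true.

Lemma nbt_cons x y z q :
  nbt x y (z :: q) = [&& adj y z, z != x & nbt y z q].
Proof. by []. Qed.

Lemma adj_neq x y : adj x y -> x != y.
Proof. by apply: contraTneq => ->; rewrite adj_irr. Qed.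

Lemma nbt_path x y p : nbt x y p -> path (@adj n T) y p.
Proof. by 
by elim: p x y => //= z q IH x y /and3P[-> _ /IH]. Qed.

(** A return to [x] would close a cycle; in a tree it has length two, and then
    the walk has backtracked at its second step. *)
Lemma nbt_uniq x y p : adj x y -> nbt x y p -> uniq [:: x, y & p].
Proof.
elim: p x y => [|z q IH] x y xy; first by rewrite /= inE adj_neq.
rewrite nbt_cons => /and3P[yz zx nq]; have uq := IH _ _ yz nq.
rewrite cons_uniq uq andbT inE negb_or (adj_neq xy) /=.
apply/negP; rewrite inE eq_sym (negbTE zx) /= => xq.
case/splitPr: xq uq nq => p1 p2 uq /nbt_path.
rewrite cat_path /= => /and3P[zp1 lx _].
have := @tree_acyclic n T [:: x, y, z & p1]; rewrite /= => H.
suff : (size [:: x, y, z & p1] <= 2)%N by [].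
apply: H; apply/andP; split.
  by rewrite /= xy yz /= rcons_path zp1 lx.
move: uq; rewrite -[_ :: z :: _]/([:: y, z & p1] ++ x :: p2) cat_uniq.
move=> /and3P[uq /hasPn/(_ x)]; rewrite mem_head => /(_ isT) xq _.
by rewrite cons_uniq uq andbT.
Qed.

(** The two sides of an edge are disjoint.  Sliding the edge along [q] moves
    steps from [q] to [p], until [q] is empty and [nbt_uniq] applies. *)
Lemma nbt_disjoint y z p q :
  adj y z -> nbt y z p -> nbt z y q -> last z p != last y q.
Proof.
elim: q y z p => [|w q IH] y z p yz np.
  move=> _; have /andP[+ _] := nbt_uniq yz np.
  by apply: contraNneq => /= <-; exact: mem_last.
rewrite nbt_cons => /and3P[yw wz nq].
have := IH w y (z :: p); apply => //; first by rewrite adj_sym.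
by rewrite nbt_cons yz eq_sym wz.
Qed.

Definition reduced y p := if p is z :: q then adj y z && nbt y z q else true.

Lemma nbt_reduced x y p : nbt x y p -> reduced y p.
Proof. by case: p => //= z q /and3P[-> _ ->]. Qed.

Lemma reduced_unique y p q :
  reduced y p -> reduced y q -> last y p = last y q -> p = q.
Proof.
elim: p y q => [|z p IH] y [|w q] // rp rq e.
- case/andP: rq => yw nq; have /andP[+ _] := nbt_uniq yw nq.
  by have := mem_last w q; rewrite -[last w q]/(last y (w :: q)) -e => ->.
- case/andP: rp => yz np; have /andP[+ _] := nbt_uniq yz np.
  by have := mem_last z p; rewrite -[last z p]/(last y (z :: p)) e => ->.
case/andP: rp => yz np; case/andP: rq => yw nq; have [ezw|zw] := eqVneq z w.
  rewrite -ezw in yw nq e *; congr cons.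
  by apply: (IH z _ (nbt_reduced np) (nbt_reduced nq)).
have /(_ (w :: q)) := nbt_disjoint yz np.
by rewrite nbt_cons yw eq_sym zw nq -[last z p]/(last y (z ::
  p)) e eqxx => /(_ isT).
Qed.

Lemma uniq_nbt x y p : path (@adj n T) y p -> uniq (y :: p) ->
  head y p != x -> nbt x y p.
Proof.
elim: p x y => //= z p IH x y /andP[-> pz] /andP[yp uz] -> /=.
apply: IH => //; apply: contraNneq yp => <-.
by case: (p) => [|w q]; rewrite !inE eqxx ?orbT.
Qed.

Lemma reducedP y z : exists2 p, reduced y p & last y p = z.
Proof.
have [p pp <-] := tree_connected y z; case/shortenP: pp => q pq uq _.
exists q => //; case: q pq uq => //= w q /andP[yw pq] /andP[yq uq].
rewrite yw; apply: uniq_nbt => //; apply: contraNneq yq => <-.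
by case: (q) => [|v r]; rewrite !inE eqxx ?orbT.
Qed.

Lemma tree_ind (P : T -> Prop) x :
  P x -> (forall y z, adj y z -> P y -> P z) -> forall y, P y.
Proof.
move=> Px PS y; have [p + <-] := tree_connected x y.
by elim: p x Px => //= z p IH x Px /andP[xz] /IH; apply; exact: PS xz Px.
Qed.

Lemma cut_path x y u p : path (@adj n T) u p -> u != x ->
  all (fun v => (v != x) && (v != y)) p -> path (cut_adj x y) u p.
Proof.
elim: p u => //= v p IH u /andP[uv pv] ux /andP[/andP[vx vy] pxy].
by rewrite /cut_adj uv !inE !xpair_eqE (negPf ux) (negPf vx) andbF /=; exact:
  IH.
Qed.

(** A simple walk that avoids the edge between [x] and [y] does not backtrack;
    conversely a walk without backtracking has distinct vertices, so it never
    comes back to this edge. *)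
Lemma branchP x y z : adj x y ->
  branch x y z <-> exists2 p, nbt x y p & last y p = z.
Proof.
move=> xy; split=> [[p]|[p np <-]].
  case/shortenP => q pq uq _ <-; exists q => //; apply: uniq_nbt => //.
    by apply: sub_path pq => u v /andP[].
  case: q pq uq => [|w q] /=; first by rewrite eq_sym adj_neq.
  move=> /andP[/andP[_]]; rewrite !inE !xpair_eqE eqxx /= negb_or.
  by move=> /andP[_].
exists p => //.
have /= /andP[xyp /andP[yp _]] := nbt_uniq xy np.
apply: cut_path (nbt_path np) _ _; first by rewrite eq_sym adj_neq.
apply/allP => v vp; apply/andP; split.
  by apply: contraNneq xyp => <-; rewrite inE vp orbT.
by apply: contraNneq yp => <-.
Qed.

Lemma branch_refl x y : branch x y y. Proof. by exists [::]. Qed.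

Lemma branch_disjoint x y z : adj x y -> branch x y z -> ~ branch y x z.
Proof.
move=> xy /(branchP _ xy)[p np pz] /branchP;
  rewrite adj_sym => /(_ xy)[q nq qz].
by have := nbt_disjoint xy np nq; rewrite pz qz eqxx.
Qed.

Lemma branch_cross x y z z' : adj x y -> branch x y z -> adj z z' ->
  ~ branch x y z' -> z = y /\ z' = x.
Proof.
move=> xy [p yp pz] zz' nz'.
have [|] := boolP ((z, z') \in [:: (x, y); (y, x)]); last first.
  move=> h; case: nz'; exists (rcons p z'); last by rewrite last_rcons.
  by rewrite rcons_path yp pz /cut_adj zz'.
rewrite !inE !xpair_eqE => /orP[/andP[_ /eqP z'y]|/andP[/eqP -> /eqP ->]//].
by case: nz'; rewrite z'y; exact: branch_refl.
Qed.

Lemma branch_total x y z : adj x y -> branch x y z \/ branch y x z.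
Proof.
move=> xy; apply: (tree_ind (x := x) (P :=
  fun z => branch x y z \/ branch y x z)).
  by right; exact: branch_refl.
move=> u v uv [] h.
  have [|nv] := pselect (branch x y v); first by left.
  by have [_ ->] := branch_cross xy h uv nv; right; exact: branch_refl.
have [|nv] := pselect (branch y x v); first by right.
rewrite adj_sym in xy.
by have [_ ->] := branch_cross xy h uv nv; left; exact: branch_refl.
Qed.

Lemma branch_sub x y z : adj x y -> adj y z -> z != x ->
  branch y z `<=` branch x y.
Proof.
move=> xy yz zx u /(branchP _ yz)[p np pu]; apply/(branchP _ xy).
by exists (z :: p) => //; rewrite nbt_cons yz zx.
Qed.

End ReducedWalks.

Section Neighbours.
Context {n : nat} {T : regular_tree n}.
Implicit Types (x y z w : T) (p q : seq T).

Lemma neighbour_enumeration x : exists e : 'I_n.+1 -> T,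
  injective e /\ forall y, adj x y <-> exists i, y = e i.
Proof.
have /card_set_bijP[f [fs fi fsu]] := tree_regular x.
have fe (i : 'I_n.+1) : exists y, adj x y /\ f y = i.
  by have [y xy fy] := fsu i (ltn_ord i); exists y.
have [e eP] := choice fe; exists e; split.
  by move=> i j eij; apply: val_inj; rewrite /= -(eP i).2 -(eP j).2 eij.
move=> y; split=> [xy|[i ->]]; last exact: (eP i).1.
exists (Ordinal (fs y xy)); apply: fi; rewrite ?inE //; first exact: (eP _).1.
by rewrite (eP _).2.
Qed.

Definition neighbour x : 'I_n.+1 -> T := projT1 (cid (neighbour_enumeration x)).

Definition neighbour_index x y : 'I_n.+1 :=
  xget ord0 [set i | neighbour x i = y].

Lemma neighbour_adj x i : adj x (neighbour x i).
Proof.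
by rewrite /neighbour; case: cid => e [ei /= eP]; apply/eP; exists i.
Qed.

Lemma neighbourK x i : neighbour_index x (neighbour x i) = i.
Proof.
rewrite /neighbour_index; case: xgetP => [j _|/(_ i)];
  last by move=> /(_ erefl).
by rewrite /= /neighbour; case: cid => e [ei eP] /ei.
Qed.

Lemma neighbour_indexK x y : adj x y -> neighbour x (neighbour_index x y) = y.
Proof.
move=> xy; have [i yi] : exists i, y = neighbour x i.
  by move: xy; rewrite /neighbour; case: cid => e [ei /= eP] /eP.
by rewrite yi neighbourK.
Qed.

Lemma neighbour_index_inj x y z : adj x y -> adj x z ->
  neighbour_index x y = neighbour_index x z -> y = z.
Proof.
by move=> xy xz e; rewrite -(neighbour_indexK xy) e neighbour_indexK.
Qed.

End Neighbours.

(** * Automorphisms prescribed on the neighbours of a vertex *)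

Section Lifting.
Context {n : nat} {T : regular_tree n}.
Implicit Types (x y z w c : T) (p q : seq T) (s : 'S_n.+1).
Local Notation adj := (@adj n T).

(** Matches the neighbours of [c] with those of [c'] by their indices, up to a
    transposition that makes [x] correspond to [x'].  A transposition being
    an involution, the inverse is the same map with the roles exchanged. *)
Definition transport x x' c c' z : T :=
  neighbour c' (tperm (neighbour_index c x) (neighbour_index c' x')
    (neighbour_index c z)).

Lemma transport_adj x x' c c' z : adj c' (transport x x' c c' z).
Proof. exact: neighbour_adj. Qed.

Lemma transportK x x' c c' z : adj c z ->
  transport x' x c' c (transport x x' c c' z) = z.
Proof.
move=> cz; rewrite /transport neighbourK tpermC tpermK.
exact: neighbour_indexK.
Qed.

Lemma transport_neq x x' c c' z : adj c x -> adj c z -> z != x ->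
  transport x x' c c' z != x'.
Proof.
move=> cx cz; apply: contraNneq => zx'.
rewrite -(transportK x x' c' cz) zx' /transport tpermL.
by rewrite neighbour_indexK.
Qed.

(** The previous vertex and its image are part of the state, so that lifts do
    not backtrack and lifting can be undone step by step. *)
Fixpoint lift_walk x x' c c' p : seq T :=
  if p is z :: q then
    let z' := transport x x' c c' z in z' :: lift_walk c c' z z' q
  else [::].

Lemma lift_walk_nbt x x' c c' p : adj c x ->
  nbt x c p -> nbt x' c' (lift_walk x x' c c' p).
Proof.
elim: p x x' c c' => // z q IH x x' c c' cx.
rewrite nbt_cons => /and3P[cz zx nq].
rewrite [lift_walk _ _ _ _ _]/= nbt_cons transport_adj transport_neq //=.
by apply: IH => //; rewrite adj_sym.
Qed.

Lemma lift_walkK x x' c c' p : nbt x c p ->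
  lift_walk x' x c' c (lift_walk x x' c c' p) = p.
Proof.
elim: p x x' c c' => // z q IH x x' c c'.
by rewrite nbt_cons => /and3P[cz zx nq] /=; rewrite transportK // IH.
Qed.

Lemma lift_walk_rcons x x' c c' p z :
  exists w, lift_walk x x' c c' (rcons p z) = rcons (lift_walk x x' c c' p) w.
Proof.
elim: p x x' c c' => [|v q IH] x x' c c';
  first by exists (transport x x' c c' z).
by have [w /= ->] := IH c c' v (transport x x' c c' v); exists w.
Qed.

Definition lift_root s y y' p : seq T :=
  if p is z :: q then
    let z' := neighbour y' (s (neighbour_index y z)) in
    z' :: lift_walk y y' z z' q
  else [::].

Lemma lift_root_reduced s y y' p :
  reduced y p -> reduced y' (lift_root s y y' p).
Proof.
case: p => // z q /andP[yz nq]; rewrite /= neighbour_adj.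
by apply: lift_walk_nbt => //; rewrite adj_sym.
Qed.

Lemma lift_rootK s y y' p : reduced y p ->
  lift_root s^-1%g y' y (lift_root s y y' p) = p.
Proof.
case: p => // z q /andP[yz nq] /=.
by rewrite neighbourK permK neighbour_indexK // lift_walkK.
Qed.

Lemma lift_root_rcons s y y' p z :
  exists w, lift_root s y y' (rcons p z) = rcons (lift_root s y y' p) w.
Proof.
case: p => [|v q]; first by exists (neighbour y' (s (neighbour_index y z))).
set v' := neighbour y' (s (neighbour_index y v)).
by have [w /= ->] := lift_walk_rcons y y' v v' q z; exists w.
Qed.

Definition walk_to y z : seq T := s2val (cid2 (reducedP y z)).

Lemma walk_to_reduced y z : reduced y (walk_to y z).
Proof. by rewrite /walk_to; case: cid2. Qed.

Lemma last_walk_to y z : last y (walk_to y z) = z.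
Proof. by rewrite /walk_to; case: cid2. Qed.

Lemma walk_toE y p : reduced y p -> walk_to y (last y p) = p.
Proof.
move=> rp; apply: reduced_unique (walk_to_reduced _ _) rp _.
exact: last_walk_to.
Qed.

Lemma nbt_step x y p v : nbt x y p -> adj (last y p) v ->
  [\/ nbt x y (rcons p v), p = [::] /\ v = x |
      exists2 q, p = rcons q (last y p) & last y q = v].
Proof.
elim: p x y => [|z p IH] x y.
  move=> _ /= yv; have [->|vx] := eqVneq v x; first by constructor 2.
  by constructor 1; rewrite yv.
rewrite nbt_cons => /and3P[yz zx np] zv.
case: (IH _ _ np zv) => [h|[-> ->]|[q -> lq]].
- by constructor 1; rewrite rcons_cons nbt_cons yz zx h.
- by constructor 3; exists [::].
- by constructor 3; exists (z :: q); rewrite //= last_rcons.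
Qed.

Lemma reduced_step y p v : reduced y p -> adj (last y p) v ->
  reduced y (rcons p v) \/ exists2 q, p = rcons q (last y p) & last y q = v.
Proof.
case: p => [_ /= yv|z p /andP[yz np] /= zv]; first by left; rewrite yv.
case: (nbt_step np zv) => [h|[-> ->]|[q -> lq]].
- by left; rewrite yz h.
- by right; exists [::].
- by right; exists (z :: q); rewrite //= last_rcons.
Qed.

Lemma reduced_rconsl y p v : reduced y (rcons p v) -> reduced y p.
Proof.
case: p => // z p /= /andP[-> ] /=.
elim: p y z => // w p IH y z; rewrite rcons_cons !nbt_cons.
by case/and3P => -> -> /IH.
Qed.

Lemma reduced_rcons_adj y p v : reduced y (rcons p v) -> adj (last y p) v.
Proof.
move=> h; have : path adj y (rcons p v).
  by case: p h => [|z p] /= /andP[-> h] //; exact: nbt_path h.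
by rewrite rcons_path => /andP[].
Qed.

(** Vertices correspond to the reduced walks from [y] that reach them. *)
Definition lift_fun s y y' v : T := last y' (lift_root s y y' (walk_to y v)).

Lemma lift_funE s y y' p : reduced y p ->
  lift_fun s y y' (last y p) = last y' (lift_root s y y' p).
Proof. by move=> rp; rewrite /lift_fun walk_toE. Qed.

Lemma lift_funK s y y' : cancel (lift_fun s y y') (lift_fun s^-1%g y' y).
Proof.
move=> v; rewrite -{1}(last_walk_to y v) lift_funE; last exact: walk_to_reduced.
rewrite lift_funE; last by apply: lift_root_reduced; exact: walk_to_reduced.
by rewrite lift_rootK ?last_walk_to //; exact: walk_to_reduced.
Qed.

Lemma lift_fun_adj s y y' u v :
  adj u v -> adj (lift_fun s y y' u) (lift_fun s y y' v).
Proof.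
have key p z : reduced y (rcons p z) ->
    adj (lift_fun s y y' (last y p)) (lift_fun s y y' z).
  move=> rp; rewrite lift_funE; last exact: reduced_rconsl rp.
  have := lift_funE s y' rp; rewrite last_rcons => ->.
  have [w e] := lift_root_rcons s y y' p z.
  have := lift_root_reduced s y' rp; rewrite e last_rcons.
  exact: reduced_rcons_adj.
rewrite -(last_walk_to y u) => uv.
have ru := walk_to_reduced y u.
case: (reduced_step ru uv) => [/key//|[q e qv]].
by rewrite adj_sym -qv; apply: key; rewrite -e.
Qed.

Lemma lift_fun_automorphism s y y' : automorphism (lift_fun s y y').
Proof.
have K' : cancel (lift_fun s^-1%g y' y) (lift_fun s y y').
  by have := @lift_funK s^-1%g y' y; rewrite invgK.
split; first by exists (lift_fun s^-1%g y' y); [exact: lift_funK|].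
move=> u v; apply/idP/idP; last exact: lift_fun_adj.
by move=> /(lift_fun_adj s^-1%g y' y); rewrite !lift_funK.
Qed.

(** All branches of a regular tree are isomorphic, so there is no obstruction
    to extending a bijection between the neighbours of two vertices. *)
Lemma aut_extension s y y' : exists k : aut T, k y = y' /\
  forall i, k (neighbour y i) = neighbour y' (s i).
Proof.
exists (SigSub (mem_set (lift_fun_automorphism s y y'))).
split; first by apply: (@lift_funE s y y' [::]).
move=> i; have := @lift_funE s y y' [:: neighbour y i].
by rewrite /= neighbour_adj neighbourK; apply.
Qed.

Lemma arc_transitive x y x' y' : adj x y -> adj x' y' ->
  exists k : aut T, k x = x' /\ k y = y'.
Proof.
move=> xy xy'.
have [k [kx kn]] := aut_extension
  (tperm (neighbour_index x y) (neighbour_index x' y')) x x'.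
exists k; split=> //.
by rewrite -(neighbour_indexK xy) kn tpermL neighbour_indexK.
Qed.

Lemma local_transposition y c d e : adj y c -> adj y d -> adj y e ->
  c != d -> c != e -> exists k : aut T, [/\ k y = y, k c = c & k d = e].
Proof.
move=> yc yd ye cd ce.
have [k [ky kn]] := aut_extension
  (tperm (neighbour_index y d) (neighbour_index y e)) y y.
exists k; split=> //.
  rewrite -(neighbour_indexK yc) kn.
  rewrite tpermD ?neighbour_indexK //.
    by apply: contraNneq cd => /(neighbour_index_inj yd yc) ->.
  by apply: contraNneq ce => /(neighbour_index_inj ye yc) ->.
by rewrite -(neighbour_indexK yd) kn tpermL neighbour_indexK.
Qed.

End Lifting.

(** * Gluing automorphisms; ways, branches and balls *)

Section Gluing.
Context {n : nat} {T : regular_tree n}.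
Implicit Types (x y z u v w : T) (g m : aut T).

Lemma aut_inj g : injective g. Proof. exact: bij_inj (autP g).1. Qed.

Lemma aut_adj g x y : adj (g x) (g y) = adj x y.
Proof. exact: (autP g).2. Qed.

Lemma autK g : cancel g (g^-1 : aut T)%g.
Proof. by move=> x; exact: inv_funK (autP g).1 x. Qed.

Lemma autVK g : cancel (g^-1 : aut T)%g g.
Proof. by move=> x; exact: inv_funVK (autP g).1 x. Qed.

Definition glue_fun g u v z : T := if `[< branch u v z >] then g z else z.

Lemma glue_fun_adj g u v x y : adj u v -> g u = u -> g v = v ->
  adj x y -> adj (glue_fun g u v x) (glue_fun g u v y).
Proof.
move=> uv gu gv xy; rewrite /glue_fun.
case: asboolP => hx; case: asboolP => hy //; first by rewrite aut_adj.
  by have [-> ->] := branch_cross uv hx xy hy; rewrite gv adj_sym.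
by rewrite adj_sym in xy; have [-> ->] := branch_cross uv hy xy hx; rewrite gv.
Qed.

Lemma glue_funK g u v : g u = u -> g v = v ->
  cancel (glue_fun g u v) (glue_fun g^-1%g u v).
Proof.
move=> gu gv z; have bg y : branch u v (g y) <-> branch u v y.
  by rewrite -{1}gu -{1}gv; exact: (branch_aut g).
rewrite /glue_fun; case: (asboolP (branch u v z)) => h; last by rewrite asboolF.
by rewrite asboolT ?autK //; exact/bg.
Qed.

(** The edge between [u] and [v], fixed by [g], is the only one that leaves the
    branch. *)
Lemma aut_glue g u v : adj u v -> g u = u -> g v = v ->
  exists m : aut T, (forall z, branch u v z -> m z = g z) /\
                    (forall z, ~ branch u v z -> m z = z).
Proof.
move=> uv gu gv.
have gu' : (g^-1 : aut T)%g u = u by rewrite -{1}gu autK.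
have gv' : (g^-1 : aut T)%g v = v by rewrite -{1}gv autK.
have K := glue_funK gu gv.
have K' : cancel (glue_fun g^-1%g u v) (glue_fun g u v).
  by have := glue_funK gu' gv'; rewrite invgK.
have am : automorphism (glue_fun g u v).
  split; first by exists (glue_fun g^-1%g u v).
  move=> x y; apply/idP/idP; last exact: glue_fun_adj.
  by move=> /(glue_fun_adj uv gu' gv'); rewrite !K.
exists (SigSub (mem_set am)); split=> z h; rewrite /= /aut_fun /= /glue_fun.
  by rewrite asboolT.
by rewrite asboolF.
Qed.

End Gluing.

Section Ends.
Context {n : nat} {T : regular_tree n}.
Implicit Types (x y z u v w : T) (a b : way T) (e : boundary T).

Lemma way_adj a i : adj (a i) (a i.+1). Proof. exact: (wayP a).1. Qed.

Lemma way_neq a i : a i.+2 != a i. Proof. exact/eqP/(wayP a).2. Qed.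

Lemma way_behind_sub a i :
  branch (a i.+1) (a i) `<=` branch (a i.+2) (a i.+1).
Proof.
by apply: branch_sub; rewrite 1?adj_sym ?way_adj // eq_sym way_neq.
Qed.

Lemma way_ahead_sub a i :
  branch (a i.+1) (a i.+2) `<=` branch (a i) (a i.+1).
Proof. by apply: branch_sub; rewrite ?way_adj // way_neq. Qed.

(** The vertices left behind by [a] are stable under adjacency: the one edge
    leaving the region behind [a] at some time is behind it one step later. *)
Lemma way_behind a z : exists N, forall i, (N <= i)%N ->
  branch (a i.+1) (a i) z.
Proof.
suff [N h] : exists i, branch (a i.+1) (a i) z.
  exists N; elim=> [|i IH]; first by rewrite leqn0 => /eqP <-.
  rewrite leq_eqVlt => /predU1P[<- //|/IH]; exact: way_behind_sub.
apply: (tree_ind (x := a 0%N) (P :=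
  fun z => exists i, branch (a i.+1) (a i) z)).
  by exists 0%N; exact: branch_refl.
move=> y w yw [i h]; have [|nw] := pselect (branch (a i.+1) (a i) w).
  by exists i.
have ai : adj (a i.+1) (a i) by rewrite adj_sym way_adj.
by have [_ ->] := branch_cross ai h yw nw; exists i.+1; exact: branch_refl.
Qed.

Lemma way_ahead a i j : (i < j)%N -> branch (a i) (a i.+1) (a j).
Proof.
move=> ij; rewrite -(subnKC ij); move: (j - i.+1)%N => k {ij}; elim:
  k i => [|k IH] i.
  by rewrite addn0; exact: branch_refl.
by rewrite addnS -addSn; exact/way_ahead_sub/IH.
Qed.

(** The branch ahead of [(x, y)] is connected and does not meet the edge
    [(u, v)], so it stays on one side of it. *)
Lemma branch_nested x y u v : adj x y -> adj u v ->
  branch y x u -> branch y x v ->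
  branch x y `<=` branch u v \/ branch x y `<=` branch v u.
Proof.
move=> xy uv xu xv; wlog yuv : u v uv xu xv / branch u v y.
  move=> H; case: (branch_total y uv) => [|h]; first exact: H.
  by case: (H v u); rewrite 1?adj_sym //; [right|left].
left => z [p]; elim/last_ind: p z => [|p w IH] z; first by move=> _ /= <-.
rewrite rcons_path last_rcons => /andP[yp /andP[pw ncut]] <-.
have hp := IH _ yp erefl; have [//|nw] := pselect (branch u v w).
have [e _] := branch_cross uv hp pw nw.
by case: (branch_disjoint xy (z := v)) => //; rewrite -e; exists p.
Qed.

Lemma way_eventually a u v : adj u v -> exists N, forall i, (N <= i)%N ->
  branch (a i) (a i.+1) `<=` branch u v \/ branch (a i) (a i.+1) `<=` branch v
    u.
Proof.
move=> uv; have [[N hN] [M hM]] := (way_behind a u, way_behind a v).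
exists (maxn N M) => i; rewrite geq_max => /andP[Ni Mi].
by apply: branch_nested => //; [exact: way_adj|exact: hN|exact: hM].
Qed.

Lemma way_shift_subproof a k : is_way (fun i => a (i + k)%N).
Proof. by split=> i; [exact: way_adj|exact/eqP/way_neq]. Qed.

Definition way_shift a k : way T := SigSub (mem_set (way_shift_subproof a k)).

Lemma endpoint_shift a k : endpoint (way_shift a k) = endpoint a.
Proof.
by apply/endpointP/way_equivP; exists 0%N, k => i; rewrite addn0.
Qed.

Lemma sub_ball (U V : set T) : U `<=` V -> ball U `<=` ball V.
Proof. by move=> UV e [a -> aU]; exists a => // i; exact/UV/aU. Qed.

Lemma ball_ahead a i : ball (branch (a i) (a i.+1)) (endpoint a).
Proof.
exists (way_shift a i.+1); first by rewrite endpoint_shift.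
by move=> j; apply: way_ahead; rewrite addnS ltnS leq_addl.
Qed.

Lemma ball_disjoint u v e :
  adj u v -> ball (branch u v) e -> ~ ball (branch v u) e.
Proof.
move=> uv [a -> ha] [b /endpointP/way_equivP[k [l ab]] hb].
by apply: (branch_disjoint uv (ha k)); have := ab 0%N; rewrite !add0n => ->.
Qed.

Lemma ball_total u v e : adj u v -> ball (branch u v) e \/ ball (branch v u) e.
Proof.
move=> uv; have [a ->] := endpoint_surj e.
have [N /(_ N (leqnn N))[]] := way_eventually a uv => /sub_ball h; [left|right];
  exact/h/ball_ahead.
Qed.

Lemma way_eventually_ball a u v : adj u v -> ball (branch u v) (endpoint a) ->
  exists N, forall i, (N <= i)%N ->
    ball (branch (a i) (a i.+1)) `<=` ball (branch u v).
Proof.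
move=> uv h; have [N hN] := way_eventually a uv;
  exists N => i /hN[|] /sub_ball //.
by move=> /(_ _ (ball_ahead a i)) /(ball_disjoint uv h).
Qed.

(** Every member of the subbase is cut out by an edge, and this edge is behind
    [a] from some time on. *)
Lemma nbhs_endpoint a (O : set (boundary T)) : nbhs (endpoint a) O ->
  exists i, ball (branch (a i) (a i.+1)) `<=` O.
Proof.
move=> [_ [[D sD <-] [J DJ Ja] sO]]; have [E sE eJ] := sD _ DJ.
have EN (B : set (boundary T)) : exists N, B \in E -> forall i, (N <= i)%N ->
    ball (branch (a i) (a i.+1)) `<=` B.
  have [BE|nBE] := pselect (B \in E); last by exists 0%N.
  have Ba : B (endpoint a) by move: Ja; rewrite -eJ; apply.
  have := set_mem (sE B BE) => -[[u [v [uv eB]]]|[u [v [uv eB]]]].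
    by rewrite eB in Ba *; have [N hN] := way_eventually_ball uv Ba; exists N.
  have vu : adj v u by rewrite adj_sym.
  have [nb|h] := ball_total (endpoint a) uv.
    by have : (~` B) (endpoint a) by rewrite eB.
  have [N hN] := way_eventually_ball vu h; exists N => _ i Ni e /(hN i Ni) eb.
  by apply: contrapT => nB; apply: (ball_disjoint vu eb); rewrite -eB.
have [N hN] := choice EN.
exists (\max_(B <- E) N B)%N => e he; apply: sO.
suff : J e by exists J.
rewrite -eJ => B BE; apply: (hN B BE) he.
exact: leq_bigmax_seq.
Qed.

Lemma reduced_way a k : reduced (a 0%N) [seq a i.+1 | i <- iota 0 k].
Proof.
case: k => //= k; rewrite way_adj.
suff /(_ 0%N) : forall j, nbt (a j) (a j.+1) [seq a i.+1 | i <- iota j.+1 k]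
  by [].
elim: k => // k IH j.
by rewrite nbt_cons way_adj way_neq; exact: IH.
Qed.

Lemma way_unique a b : a 0%N = b 0%N -> endpoint a = endpoint b -> a =1 b.
Proof.
move=> ab0 /endpointP/way_equivP[k [l ab]].
have la (c : way T) j : last (c 0%N) [seq c i.+1 | i <- iota 0 j] = c j.
  by case: j => // j; rewrite -[j.+1]addn1 iotaD map_cat last_cat /= addn1.
move=> i; have := reduced_way b (i + l); rewrite -ab0 => rb.
have := reduced_unique (reduced_way a (i + k)) rb;
  rewrite la ab0 la => /(_ (ab i)).
move=> e; have := congr1 size e; rewrite !size_map !size_iota => ekl.
case: i e {rb} ekl => // i e ekl.
have := congr1 (fun s => nth (a 0%N) s i) e.
by rewrite !(nth_map 0%N) ?size_iota ?nth_iota ?addSn ?add0n // leq_addr.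
Qed.

End Ends.

(** * The topologies of the two groups; translations *)

Section Topology.
Context {n : nat} {T : regular_tree n}.
Implicit Types (x y z u v w : T) (g k m : aut T) (F : set T).

Lemma stabilizerM F g k :
  stabilizer F g -> stabilizer F k -> stabilizer F (g * k)%g.
Proof. by move=> gF kF x Fx; rewrite -{2}(gF x Fx) -{2}(kF x Fx). Qed.

Lemma stabilizerV F g : stabilizer F g -> stabilizer F g^-1%g.
Proof. by move=> gF x Fx; rewrite -{1}(gF x Fx) autK. Qed.

Lemma nbhs_aut k (A : set (aut T)) : nbhs k A ->
  exists2 F, finite_set F & forall s, stabilizer F s -> A (k * s)%g.
Proof.
move=> [_ [[D sD <-] [J DJ Jk] sA]]; have [E sE eJ] := sD _ DJ.
have EF (B : set (aut T)) : exists F, finite_set F /\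
    (B \in E -> forall s, stabilizer F s -> B (k * s)%g).
  have [BE|nBE] := pselect (B \in E); last by exists set0; split.
  have Bk : B k by move: Jk; rewrite -eJ; apply.
  have := set_mem (sE B BE) => -[g [F [fF _ eB]]]; exists F; split=> // _ s sF.
  rewrite eB in Bk *; have [r rF <-] := Bk.
  by exists (r * s)%g; [exact: stabilizerM|rewrite mulgA].
have [F FP] := choice EF.
exists (\bigcup_(B in [set` E]) F B).
  by apply: bigcup_finite => [|B _]; [exact: finite_fset|exact: (FP B).1].
move=> s sF; apply: sA; suff : J (k * s)%g by exists J.
rewrite -eJ => B BE; apply: (FP B).2 => // x Fx; apply: sF; exists B => //.
Qed.

(** Single vertices are subtrees, and [F] is a finite union of them. *)
Lemma nbhs_autP k F (A : set (aut T)) : finite_set F ->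
  (forall s, stabilizer F s -> A (k * s)%g) -> nbhs k A.
Proof.
move=> /finite_fsetP[X eF] sA.
apply: (@filterS _ (nbhs k) _
    (\bigcap_(x in [set` X]) [set (k * s)%g | s in stabilizer [set x]])).
  move=> g hg; rewrite -[g](mulKVg k); apply: sA => x; rewrite eF => xX.
  by have [s /(_ x erefl) sx <-] := hg x xX; rewrite mulKg.
apply: filter_bigI => x _.
set B := [set (k * s)%g | s in stabilizer [set x]].
exists B; split; first last.
- by [].
- by exists 1%g; rewrite ?mulg1.
exists [set B]; last by rewrite bigcup_set1.
move=> _ ->; apply: (@finI_from1 _ _ _ idfun).
exists k, [set x]; split=> //.
by move=> _ _ -> ->; exists [::].
Qed.




Lemma hier_of_aut1 : \d (1%g : aut T) = 1%g.
Proof. by apply: hier_eq => e; exact: boundary_act1. Qed.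

Lemma hier_of_autV k : \d (k^-1%g) = (\d k)^-1%g.
Proof.
by apply/eqP; rewrite -mulg_eq1 -hier_of_autM mulVg hier_of_aut1.
Qed.

Lemma nbhs_hier (p : hier T) (U : set (hier T)) : nbhs p U ->
  exists2 F, finite_set F & forall k, stabilizer F k -> U (p * \d k)%g.
Proof.
rewrite nbhsE => -[O [oO Op] OU].
have [|F fF hF] := @nbhs_aut 1%g [set k | O (p * \d k)%g].
  by apply: open_nbhs_nbhs; split; [exact: (oO :
    hier_open O) p|rewrite /= hier_of_aut1 mulg1].
by exists F => // k /hF; rewrite mul1g => /OU.
Qed.

Lemma nbhs_hierP (p : hier T) F (U : set (hier T)) : finite_set F ->
  (forall k, stabilizer F k -> U (p * \d k)%g) -> nbhs p U.
Proof.
move=> fF hU; pose O := [set (p * \d k)%g | k in stabilizer F].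
have : open O.
  rewrite -[open _]/(hier_open _) => q; rewrite openE => k [s sF e].
  apply: (nbhs_autP (F := F)) => // r rF /=.
  exists (s * r)%g; first exact: stabilizerM.
  by rewrite !hier_of_autM !mulgA e.
move=> oO; rewrite nbhsE; exists O; last by move=> _ [k kF <-]; exact: hU.
by split=> //; exists 1%g; rewrite ?hier_of_aut1 ?mulg1.
Qed.

End Topology.


Section Local.
Context {n : nat} {T : regular_tree n}.
Implicit Types (x y z u v w : T) (g k m t : aut T) (F : set T).
Implicit Types (e : boundary T) (p q h : hier T).

(** [t] moves the vertices [x], [y], [t y] one step along a line. *)
Definition translates t x y := [/\ adj x y, t x = y & t y != x].

Lemma translatesV t x y : translates t x y -> translates t^-1%g y x.
Proof.
move=> [xy tx ty]; split; first by rewrite adj_sym.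
  by rewrite -tx autK.
by apply: contraNneq ty => <-; rewrite autVK.
Qed.

Lemma translation_exists : (0 < n)%N -> exists t x y, translates t x y.
Proof.
move=> n0; have [x] := tree_nonempty T.
pose y := neighbour x ord0; have yx : adj y x by rewrite adj_sym neighbour_adj.
have [z [yz zx]] : exists z, adj y z /\ z != x.
  have [e|ne] := eqVneq (neighbour y ord0) x; last first.
    by exists (neighbour y ord0); rewrite neighbour_adj.
  exists (neighbour y ord_max); rewrite neighbour_adj; split=> //.
  rewrite -e; apply/eqP => /(congr1 (neighbour_index y)); rewrite !neighbourK.
  by move=> /(congr1 val) /= n0'; rewrite n0' in n0.
have xy : adj x y by rewrite adj_sym.
have [t [tx ty]] := arc_transitive xy yz.
by exists t, x, y; split=> //; rewrite ty.
Qed.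

Lemma iter_aut_inj t i : injective (iter i t).
Proof. by elim: i => //= i IH u v /aut_inj /IH. Qed.

Lemma orbit_way_subproof t x y :
  translates t x y -> is_way (fun i => iter i t x).
Proof.
move=> [xy tx ty]; have ad i : adj (iter i t x) (iter i.+1 t x).
  by elim: i => [|i IH]; [rewrite /= tx|rewrite [iter i.+1 _ _]iterS [iter
    i.+2 _ _]iterS aut_adj].
split=> [//|i]; rewrite -addn2 iterD => /iter_aut_inj /= e.
by move: ty; rewrite -tx e eqxx.
Qed.

Definition orbit_way t x y (h : translates t x y) : way T :=
  SigSub (mem_set (orbit_way_subproof h)).

Lemma translate_sub t x y : translates t x y ->
  branch (t x) (t y) `<=` branch x y.
Proof.
move=> [xy tx ty]; rewrite tx; apply: branch_sub => //.
by rewrite -tx aut_adj tx.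
Qed.

Lemma ball_actE g x y e :
  ball (branch (g x) (g y)) (boundary_act g e) <-> ball (branch x y) e.
Proof.
split=> h; first by have := ball_act h; rewrite boundary_actK.
have := @ball_act _ _ g^-1%g (g x) (g y) e; rewrite invgK; apply.
by rewrite !autK.
Qed.

(** Near some end [q] acts as an automorphism [r], which right multiplication
    cancels; arc-transitivity then brings the ball obtained to the given one. *)
Lemma hier_fixes_ball q x y : (0 < n)%N -> adj x y -> exists k1 k2 : aut T,
  forall e, ball (branch x y) e -> (\d k1 * q * \d k2 : hier T)%g e = e.
Proof.
move=> n0 xy; have [t [x0 [y0 h]]] := translation_exists n0.
pose a := orbit_way h.
have [_ _ _ /(_ (endpoint a))[r hr]] := hierP q.
have [i hi] := nbhs_endpoint hr.
have [k [kx ky]] := arc_transitive xy (way_adj a i).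
exists (k^-1 * r^-1)%g, k => e he.
have {}he : ball (branch (a i) (a i.+1)) (boundary_act k e).
  by rewrite -kx -ky; apply/ball_actE.
have -> : (\d (k^-1 * r^-1) * q * \d k : hier T)%g e =
    boundary_act (k^-1 * r^-1)%g (q (boundary_act k e)) by [].
by rewrite (hi _ he) boundary_actM /= !boundary_actK.
Qed.

(** The supports are disjoint, and each of the two maps preserves its own. *)
Lemma fixes_commute (A B : set (boundary T)) p q : (forall e, A e \/ B e) ->
  (forall e, A e -> p e = e) -> (forall e, B e -> q e = e) -> (p * q = q * p)%g.
Proof.
move=> AB pA qB; have inj (f : hier T) : injective f.
  by case: (hierP f) => /bij_inj.
have key (A' B' : set (boundary T)) (f g : hier T) e :
  (forall e, A' e \/ B' e) ->
  (forall e, A' e -> f e = e) -> (forall e, B' e -> g e = e) -> B' e ->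
  f (g e) = g (f e).
  move=> AB' fA gB Be; rewrite (gB e Be); case:
    (AB' (f e)) => [/fA/inj ->|/gB ->] //.
  by rewrite gB.
apply: hier_eq => e; have [Ae|Be] := AB e; last exact: (key A B).
by apply/esym/(key B A) => // e'; case: (AB e'); [right|left].
Qed.

(** Conjugation by [t^j] pushes the support of [q] further into the ball on
    which [p] is the identity. *)
Lemma translates_commute t x y p q j : translates t x y ->
  (forall e, ball (branch x y) e -> p e = e) ->
  (forall e, ball (branch y x) e -> q e = e) ->
  (p * (\d (t ^+ j) * q * \d (t ^- j)) = \d (t ^+ j) * q * \d (t ^- j) * p)%g.
Proof.
move=> txy pid qid; have [xy _ _] := txy.
have sub : branch ((t ^+ j : aut T)%g x) ((t ^+ j : aut T)%g y) `<=` branch x y.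
  elim: j => [|j IH]; first by rewrite expg0.
  rewrite expgSr => z; set g := (t ^+ j)%g in IH *.
  rewrite -[z](autVK g) => /(@branch_aut _ _ g (t x) (t y)) /(translate_sub
    txy) hz.
  by apply: IH; apply/branch_aut.
apply: (fixes_commute (A := ball (branch x y))
  (B := ball (branch ((t ^+ j : aut T)%g y) ((t ^+ j : aut T)%g x)))) => //.
  have tj : adj ((t ^+ j : aut T)%g x) ((t ^+ j :
    aut T)%g y) by rewrite aut_adj.
  by move=> e; case: (ball_total e tj); [left; exact: sub_ball sub _ _|right].
move=> e he.
have -> : (\d (t ^+ j) * q * \d (t ^- j) : hier T)%g e =
  boundary_act (t ^+ j)%g (q (boundary_act (t ^- j)%g e)) by [].
by rewrite qid ?boundary_actVK //; exact: ball_act.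
Qed.

End Local.

(** * Commensurated stabilizers; generators of the automorphism group *)

Section Commensuration.
Context {n : nat} {T : regular_tree n}.
Implicit Types (x y z u v w : T) (g k m r : aut T) (F : set T).
Implicit Types (e : boundary T) (q : hier T) (a : way T).

Lemma boundary_act_eq_on (U : set T) m g : (forall z, U z -> m z = g z) ->
  forall e, ball U e -> boundary_act m e = boundary_act g e.
Proof.
move=> mg e [a -> aU]; rewrite !boundary_act_endpoint; congr endpoint.
by apply/val_inj/funext => i; exact/mg/aU.
Qed.

Lemma boundary_act_id_on (U : set T) m : (forall z, U z -> m z = z) ->
  forall e, ball U e -> boundary_act m e = e.
Proof.
by move=> mU e /(@boundary_act_eq_on U m 1%g mU) ->; exact: boundary_act1.
Qed.

Lemma ball_act_supported (U : set T) m : (forall z, ~ U z -> m z = z) ->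
  forall e, ball U e -> ball U (boundary_act m e).
Proof.
move=> mU e [a -> aU]; rewrite boundary_act_endpoint;
  exists (way_map m a) => // i.
apply: contrapT => h; apply: (h); rewrite /= in h *.
by move: (mU _ h) => /aut_inj ->.
Qed.

Lemma sibling_disjoint v w w' z : adj v w -> adj v w' -> w != w' ->
  branch v w z -> ~ branch v w' z.
Proof.
move=> vw vw' ww' /(branch_disjoint vw) nb h; apply: nb.
by move: h; apply: branch_sub => //; [rewrite adj_sym|rewrite eq_sym].
Qed.

Definition neighbours v : seq T := [seq neighbour v i | i <- enum 'I_n.+1].

Lemma mem_neighbours v w : (w \in neighbours v) = adj v w.
Proof.
apply/mapP/idP => [[i _ ->]|vw]; first exact: neighbour_adj.
by exists (neighbour_index v w); rewrite ?mem_enum ?neighbour_indexK.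
Qed.

Lemma uniq_neighbours v : uniq (neighbours v).
Proof.
by rewrite map_inj_uniq ?enum_uniq //; exact: can_inj (@neighbourK _ _ v).
Qed.

(** Follow the way until [v] and all the edges at [v] are behind it; the first
    step from [v] towards the way then gives [w]. *)
Lemma ball_child v e : exists2 w, adj v w & ball (branch v w) e.
Proof.
have [a ->] := endpoint_surj e.
have [M hM] := way_behind a v.
have [N hN] := choice (fun i => way_eventually a (neighbour_adj v i)).
pose K := maxn M (\max_i N i).
have /hM vK : (M <= K)%N by exact: leq_maxl.
have aK : adj (a K.+1) (a K) by rewrite adj_sym way_adj.
have [[|w p] rp lp] := reducedP v (a K.+1).
  by case: (branch_disjoint aK vK); rewrite -[v]/(last v [::]) lp; exact:
    branch_refl.
case/andP: rp => vw np.
have bw : branch v w (a K.+1) by apply/branchP => //; exists p.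
exists w => //.
have KN : (N (neighbour_index v w) <= K)%N.
  by rewrite leq_max; apply/orP; right; exact: leq_bigmax.
have := hN _ _ KN; rewrite neighbour_indexK // => -[/sub_ball|] h.
  exact/h/ball_ahead.
by case: (branch_disjoint vw bw); apply: h; exact: branch_refl.
Qed.

(** Conjugation by [q] turns the automorphisms close to the identity into
    automorphisms, as far as the ends in the branch are concerned.  Asking [m]
    to be trivial off the branch lets such automorphisms be multiplied over
    disjoint branches. *)
Definition tame q F u v := exists2 F', finite_set F' &
  forall k, stabilizer F' k -> exists m,
    [/\ stabilizer F m, forall z, ~ branch u v z -> m z = z &
     forall e, ball (branch u v) e ->
       q (boundary_act m e) = boundary_act k (q e)].

(** Here [q^-1 k q] is [r^-1 k r]; with [r u] and [r v] fixed by [k] it can be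
    replaced by the identity off the branch. *)
Lemma tame_local q F u v r : finite_set F -> adj u v ->
  (forall e, ball (branch u v) e -> q e = boundary_act r e) -> tame q F u v.
Proof.
move=> fF uv qr; exists (r @` (F `|` [set u; v])).
  by apply: finite_image; rewrite finite_setU; split=> //; exact: finite_set2.
move=> k hk; pose g : aut T := (r^-1 * k * r)%g.
have gE z : (F `|` [set u; v]) z -> g z = z.
  move=> h; have : k (r z) = r z by apply: hk; exists z.
  by rewrite -[g z]/((r^-1 : aut T)%g (k (r z))) => ->; rewrite autK.
have gu : g u = u by apply: gE; right; left.
have gv : g v = v by apply: gE; right; right.
have [m [mb mo]] := aut_glue uv gu gv.
exists m; split=> //.
  move=> z Fz; have [/mb ->|/mo //] := pselect (branch u v z).
  by apply: gE; left.
move=> e he; rewrite (boundary_act_eq_on mb he) qr; last first.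
  by rewrite -[X in branch X]gu -[X in branch _ X]gv; apply/ball_actE.
rewrite (qr e he) -[LHS](boundary_actM r g) /g !mulgA mulgV mul1g.
exact: boundary_actM.
Qed.

(** The automorphisms given by the branches have disjoint supports: on each
    branch their product acts as its own factor. *)
Lemma tame_join q F v (ws : seq T) : uniq ws -> {in ws, forall w, adj v w} ->
  {in ws, forall w, tame q F v w} ->
  exists2 F', finite_set F' & forall k, stabilizer F' k -> exists m,
    [/\ stabilizer F m, forall z, {in ws, forall w, ~ branch v w z} -> m z = z &
     forall w e, w \in ws -> ball (branch v w) e ->
       q (boundary_act m e) = boundary_act k (q e)].
Proof.
elim: ws => [|w ws IH].
  by move=> _ _ _; exists set0 => // k _; exists 1%g; split.
rewrite cons_uniq => /andP[wws uws] vws tws.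
have vw : adj v w by apply: vws; rewrite mem_head.
have [||F1 fF1 h1] := IH uws.
- by move=> w' h; apply: vws; rewrite inE h orbT.
- by move=> w' h; apply: tws; rewrite inE h orbT.
have [|F2 fF2 h2] := tws w; first by rewrite mem_head.
exists (F1 `|` F2); first by rewrite finite_setU.
move=> k hk; have [|m1 [m1F m1o m1q]] := h1 k; first by move=> z ?; apply:
  hk; left.
have [|m2 [m2F m2o m2q]] := h2 k; first by move=> z ?; apply: hk; right.
have sib w' : w' \in ws -> [/\ adj v w' & w != w'].
  move=> h; split; first by apply: vws; rewrite inE h orbT.
  by apply: contraNneq wws => ->.
exists (m1 * m2)%g; split; first exact: stabilizerM.
  move=> z hz; rewrite -[LHS]/(m1 (m2 z)) m2o; last by apply: hz;
    rewrite mem_head.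
  by apply: m1o => w' h; apply: hz; rewrite inE h orbT.
move=> w' e; rewrite inE boundary_actM /= => /predU1P[->|h] he.
  rewrite (@boundary_act_id_on (branch v w) m1) ?m2q //; last exact:
    ball_act_supported.
  by move=> z hz; apply: m1o => w'' /sib[vw'' ne]; exact: sibling_disjoint hz.
rewrite (@boundary_act_id_on (branch v w') m2) ?(m1q w') //.
have [vw' ne] := sib _ h.
by move=> z hz; apply: m2o => bz; exact: (sibling_disjoint vw vw' ne bz).
Qed.

Lemma tame_step q F u v : adj u v ->
  (forall w, adj v w -> w != u -> tame q F v w) -> tame q F u v.
Proof.
move=> uv tv; have [||| F' fF' h] :=
  @tame_join q F v [seq w <- neighbours v | w != u].
- exact/filter_uniq/uniq_neighbours.
- by move=> w; rewrite mem_filter mem_neighbours => /andP[].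
- by move=> w; rewrite mem_filter mem_neighbours => /andP[wu vw]; exact: tv.
exists F' => // k /h[m [mF mo mq]]; exists m; split=> //.
  move=> z nz; apply: mo => w; rewrite mem_filter mem_neighbours =>
    /andP[wu vw] bz.
  by apply: nz; exact: branch_sub bz.
move=> e he; have [w vw bw] := ball_child v e; apply: (mq w) => //.
rewrite mem_filter mem_neighbours vw andbT; apply:
  contra_notN (ball_disjoint uv he).
by move=> /eqP <-.
Qed.

(** If the branch at [(u, v)] is not tame, some branch one step further is not,
    and so on along a way.  But near the end of this way [q] acts as an
    automorphism, against [tame_local]. *)
Lemma tame_all q F u v : finite_set F -> adj u v -> tame q F u v.
Proof.
move=> fF uv; apply: contrapT => ntuv.
have next (p : T * T) : exists w, adj p.1 p.2 -> ~ tame q F p.1 p.2 ->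
    [/\ adj p.2 w, w != p.1 & ~ tame q F p.2 w].
  have [ap|] := pselect (adj p.1 p.2); last by exists u.
  apply: contrapT => nw; have [] := pselect (tame q F p.1 p.2).
    by move=> h; apply: nw; exists u.
  move=> nt; apply: (nt); apply: tame_step => // w pw wp.
  by apply: contrapT => ntw; apply: nw; exists w.
have [f fP] := choice next.
pose s i := iter i (fun p : T * T => (p.2, f p)) (u, v).
have sP i : adj (s i).1 (s i).2 /\ ~ tame q F (s i).1 (s i).2.
  by elim: i => [|i [ai ti]] //=; have [] := fP (s i) ai ti.
have s_way : is_way (fun i => (s i).1).
  split=> i; first exact: (sP i).1.
  by have [_ /eqP] := fP (s i) (sP i).1 (sP i).2.
pose a : way T := SigSub (mem_set s_way).
have [_ _ _ /(_ (endpoint a))[r hr]] := hierP q.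
have [i hi] := nbhs_endpoint hr.
by apply: (sP i).2; exact: tame_local fF (sP i).1 hi.
Qed.

(** Equivalently, [q L q^-1] contains the stabilizer of [F'], for [L] the
    stabilizer of [F]: conjugation by [q] is continuous at the identity. *)
Lemma hier_commensurates q F : finite_set F -> exists2 F', finite_set F' &
  forall k, stabilizer F' k -> exists2 m, stabilizer F m &
    (hier_of_aut k * q = q * hier_of_aut m)%g.
Proof.
move=> fF; have [x] := tree_nonempty T.
have [||| F' fF' h] := @tame_join q F x (neighbours x).
- exact: uniq_neighbours.
- by move=> w; rewrite mem_neighbours.
- by move=> w; rewrite mem_neighbours => xw; exact: tame_all.
exists F' => // k /h[m [mF _ mq]]; exists m => //; apply: hier_eq => e.
have [w xw bw] := ball_child x e; apply/esym; apply: (mq w) => //.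
by rewrite mem_neighbours.
Qed.

End Commensuration.

Section Generation.
Context {n : nat} {T : regular_tree n}.
Implicit Types (x y z u v w : T) (g k m r t : aut T).

Lemma third_neighbour y x z : (1 < n)%N -> exists w, [/\ adj y w,
  w != x & w != z].
Proof.
move=> n1; pose A := [:: neighbour_index y x; neighbour_index y z].
have [i iA] : exists i, i \notin A.
  apply: contrapT => h; have : (#|'I_n.+1| <= size A)%N.
    apply: leq_trans (card_size A);
      apply/subset_leq_card/fintype.subsetP => i _; apply: contrapT => /negP iA.
    by apply: h; exists i.
  by rewrite card_ord /= ltnNge n1.
exists (neighbour y i); rewrite neighbour_adj; split=> //.
  by apply: contraNneq iA => e; rewrite !inE -e neighbourK eqxx.
by apply: contraNneq iA => e; rewrite !inE -e neighbourK eqxx orbT.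
Qed.

(** An automorphism fixing [x] and [y] is a product of two elements supported
    on the two sides of this edge, so it is in [L]; conjugating by [t], those
    fixing [y] and [t y] are in [L] too.  Thanks to a third neighbour of [y],
    these two subgroups move [x] to any neighbour of [y], so [L] contains the
    stabilizer of [y].  As [t] moves [y] to a neighbour, [L] is transitive on
    vertices by connectedness. *)
Lemma aut_generated (L : set (aut T)) t x y : (1 < n)%N ->
  (forall g k, L g -> L k -> L (g * k)%g) -> (forall g, L g -> L g^-1%g) ->
  translates t x y -> L t ->
  (forall g, (forall z, branch x y z -> g z = z) -> L g) ->
  (forall g, (forall z, branch y x z -> g z = z) -> L g) ->
  forall k, L k.
Proof.
move=> n1 LM LV [xy tx ty] Lt Lxy Lyx; set z := t y in ty *.
have yx : adj y x by rewrite adj_sym.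
have yz : adj y z by rewrite -tx aut_adj.
have cancelL g k : L g -> L (g * k)%g -> L k.
  by move=> /LV Lg /(LM _ _ Lg); rewrite mulKg.
have Kxy k : k x = x -> k y = y -> L k.
  move=> kx ky; have [m [mb mo]] := aut_glue xy kx ky.
  have Lm : L m by apply: Lyx => u /(branch_disjoint yx) /mo.
  apply: (cancelL m^-1%g); first exact: LV.
  by apply: Lxy => u hu; rewrite -[LHS]/((m^-1 : aut T)%g (k u)) -mb // autK.
have Kyz k : k y = y -> k z = z -> L k.
  move=> ky kz; have : L (t^-1 * (k * t))%g.
    apply: Kxy; rewrite -[LHS]/((t^-1 :
      aut T)%g (k (t _))) ?tx ?ky ?kz ?autK //.
    by rewrite -tx autK.
  move=> /(LM _ _ Lt); rewrite mulKVg => /LM /(_ (LV _ Lt)).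
  by rewrite mulgK.
have Ky' k : k y = y -> k x != z -> L k.
  move=> ky kxz; have ykx : adj y (k x) by rewrite -ky aut_adj.
  have [||l [ly lz lx]] := local_transposition yz ykx yx => //.
    by rewrite eq_sym.
  by apply: (cancelL l); [exact: Kyz|apply: Kxy; rewrite -[LHS]/(l (k _)) ?ky].
have Ky k : k y = y -> L k.
  move=> ky; have [kxz|] := eqVneq (k x) z; last exact: Ky'.
  have [w [yw wx wz]] := third_neighbour y x z n1.
  have [||l [ly lx lz]] := local_transposition yx yz yw; rewrite 1?eq_sym //.
  apply: (cancelL l); first exact: Kxy.
  apply: Ky'; first by rewrite -[LHS]/(l (k y)) ky.
  by rewrite -[X in X != _]/(l (k x)) kxz lz.
move=> k; suff [l Ll lk] : exists2 l, L l & l y = k y.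
  apply: (cancelL l^-1%g); first exact: LV.
  by apply: Ky; rewrite -[LHS]/((l^-1 : aut T)%g (k y)) -lk autK.
apply: (tree_ind (x := y) (P := fun v => exists2 l, L l & l y = v)).
  by exists 1%g => //; apply: Kxy.
move=> _ v /[swap] -[l Ll <-] lv.
have lv' : adj y ((l^-1 : aut T)%g v) by rewrite -(aut_adj l) autVK.
have [m [my mx]] := arc_transitive yx lv'.
exists (l * (m * t^-1))%g.
  by apply: (LM) => //; apply: (LM); [exact: Ky|exact: LV].
have ty' : (t^-1 : aut T)%g y = x by rewrite -tx autK.
by rewrite -[LHS]/(l (m ((t^-1 : aut T)%g y))) ty' mx autVK.
Qed.

End Generation.

(** * The real inner product of a Hilbert space *)

Section RealInnerProduct.
Context {R : realType} {H : hilbert_space R}.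
Local Open Scope ring_scope.
Implicit Types (x y z : H) (a b c : R) (u : nat -> H).

(** The real part of the inner product has values in an ordered field and
    determines the inner product, see [hdot_eq]. *)
Definition rdot x y : R := complex.Re (hdot H x y).
Definition nrm x : R := complex.Re `|x|.

Lemma hdotC x y : hdot H x y = conjc (hdot H y x).
Proof. by rewrite (hermC (hdot H) x y) expr0 mul1r. Qed.

Lemma hdotDl x y z : hdot H (x + y) z = hdot H x z + hdot H y z.
Proof. by rewrite linearDl. Qed.

Lemma hdotZl (a : R[i]) x z : hdot H (a *: x) z = a * hdot H x z.
Proof. by rewrite linearZl_LR. Qed.

Lemma hdotZr (a : R[i]) x z : hdot H z (a *: x) = conjc a * hdot H z x.
Proof. by rewrite linearZr_LR. Qed.

Lemma hdotDr x y z : hdot H z (x + y) = hdot H z x + hdot H z y.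
Proof. by rewrite linearDr. Qed.

Lemma hdot0l z : hdot H 0 z = 0. Proof. by rewrite linear0l. Qed.

Lemma hdot0r z : hdot H z 0 = 0. Proof. by rewrite linear0r. Qed.

Lemma normr_nrm x : `|x| = (nrm x)%:C%C.
Proof. by rewrite /nrm RRe_real // ger0_real. Qed.

Lemma nrm_ge0 x : 0 <= nrm x.
Proof. by rewrite -lecR -normr_nrm normr_ge0. Qed.

Lemma rdotC x y : rdot x y = rdot y x.
Proof.
by rewrite /rdot hdotC; case: (hdot H y x).
Qed.

Lemma rdotDl x y z : rdot (x + y) z = rdot x z + rdot y z.
Proof. by rewrite /rdot hdotDl; case: (hdot H x z) (hdot H y z) => ? ? []. Qed.

Lemma rdotNl x z : rdot (- x) z = - rdot x z.
Proof. by rewrite -scaleN1r /rdot hdotZl mulN1r; case: (hdot H x z). Qed.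

Lemma rdotZl a x z : rdot (a%:C%C *: x) z = a * rdot x z.
Proof.
by rewrite /rdot hdotZl; case: (hdot H x z) => r s /=; rewrite mul0r subr0.
Qed.

Lemma rdotDr x y z : rdot z (x + y) = rdot z x + rdot z y.
Proof. by rewrite !(rdotC z) rdotDl. Qed.

Lemma rdotNr x z : rdot z (- x) = - rdot z x.
Proof. by rewrite !(rdotC z) rdotNl. Qed.

Lemma rdotZr a x z : rdot z (a%:C%C *: x) = a * rdot z x.
Proof. by rewrite !(rdotC z) rdotZl. Qed.

Lemma rdotBl x y z : rdot (x - y) z = rdot x z - rdot y z.
Proof. by rewrite rdotDl rdotNl. Qed.

Lemma rdotBr x y z : rdot z (x - y) = rdot z x - rdot z y.
Proof. by rewrite rdotDr rdotNr. Qed.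

Lemma rdot0l z : rdot 0 z = 0.
Proof. by rewrite -(subrr z) rdotBl subrr. Qed.

Lemma rdot0r z : rdot z 0 = 0. Proof. by rewrite rdotC rdot0l. Qed.

Lemma rdot_i x y : rdot ('i%C *: x) y = - complex.Im (hdot H x y).
Proof.
rewrite /rdot hdotZl; case: (hdot H x y) => r s /=.
by rewrite mul0r mul1r sub0r.
Qed.

Lemma rdot_ii x y : rdot ('i%C *: x) ('i%C *: y) = rdot x y.
Proof.
rewrite rdot_i hdotZr /rdot; case: (hdot H x y) => r s /=.
by rewrite mul0r mulN1r add0r opprK.
Qed.

Lemma hdot_eq x y x' y' : rdot x y = rdot x' y' ->
  rdot ('i%C *: x) y = rdot ('i%C *: x') y' -> hdot H x y = hdot H x' y'.
Proof.
rewrite !rdot_i /rdot => e /oppr_inj; move: e.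
by case: (hdot H x y) (hdot H x' y') => ? ? [? ?] /= -> ->.
Qed.

Lemma rdotxx x : rdot x x = nrm x ^+ 2.
Proof. by rewrite /rdot hdot_norm normr_nrm -rmorphXn. Qed.

Lemma nrm_eq0 x : (nrm x == 0) = (x == 0).
Proof. by rewrite -(normr_eq0 x) normr_nrm (inj_eq (@complexI _)). Qed.

Lemma nrm0 : nrm 0 = 0. Proof. by apply/eqP; rewrite nrm_eq0. Qed.

Lemma rdotxx_gt0 x : x != 0 -> 0 < rdot x x.
Proof. by move=> x0; rewrite rdotxx exprn_gt0 // lt_def nrm_ge0 nrm_eq0 x0. Qed.

Lemma nrmD x y : nrm (x + y) <= nrm x + nrm y.
Proof. by rewrite -lecR rmorphD /= -!normr_nrm ler_normD. Qed.

Lemma nrmN x : nrm (- x) = nrm x. Proof. by rewrite /nrm normrN. Qed.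

Lemma nrmBC x y : nrm (x - y) = nrm (y - x).
Proof. by rewrite -nrmN opprB. Qed.

Lemma nrmB x y : nrm (x - y) <= nrm x + nrm y.
Proof. by rewrite -(nrmN y) nrmD. Qed.

Lemma nrm_triangle y x z : nrm (x - z) <= nrm (x - y) + nrm (y - z).
Proof. by rewrite -(subrKA y) nrmD. Qed.

Lemma nrmZ a x : nrm (a%:C%C *: x) = `|a| * nrm x.
Proof.
apply/eqP; rewrite -(@eqrXn2 _ 2) ?nrm_ge0 ?mulr_ge0 ?nrm_ge0 //.
by rewrite -rdotxx rdotZl rdotZr rdotxx exprMn real_normK ?num_real // mulrA.
Qed.

Lemma nrmZc (a : R[i]) x : nrm (a *: x) = complex.Re `|a| * nrm x.
Proof.
have ra : (complex.Re `|a|)%:C%C = `|a| by rewrite RRe_real // ger0_real.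
by apply: (@complexI R); rewrite rmorphM /= ra -!normr_nrm normrZ.
Qed.

Lemma nrmi x : nrm ('i%C *: x) = nrm x.
Proof.
by apply/eqP; rewrite -(@eqrXn2 _ 2) ?nrm_ge0 // -!rdotxx rdot_ii.
Qed.

Lemma rdot_le x y : rdot x y <= nrm x * nrm y.
Proof.
have [->|y0] := eqVneq y 0; first by rewrite rdot0r nrm0 mulr0.
have [->|x0] := eqVneq x 0; first by rewrite rdot0l nrm0 mul0r.
have ny : 0 < nrm y by rewrite lt_def nrm_ge0 nrm_eq0 y0.
have : 0 <= rdot (((nrm y)%:C)%C *: x - ((nrm x)%:C)%C *: y)
                 (((nrm y)%:C)%C *: x - ((nrm x)%:C)%C *: y).
  by rewrite rdotxx sqr_ge0.
rewrite !(rdotBl, rdotBr, rdotZl, rdotZr) (rdotC y x) !rdotxx.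
have nx : 0 < nrm x by rewrite lt_def nrm_ge0 nrm_eq0 x0.
have nxy : 0 < nrm x * nrm y by rewrite mulr_gt0.
set p := nrm x in nx nxy *; set q := nrm y in ny nxy *; set d := rdot x y => h.
rewrite -(ler_pM2l nxy); nra.
Qed.

Lemma rdot_norm x y : `|rdot x y| <= nrm x * nrm y.
Proof. by rewrite ler_norml rdot_le andbT lerNl -rdotNl -(nrmN x) rdot_le. Qed.

Lemma rdot_ext x y : (forall z, rdot x z = rdot y z) -> x = y.
Proof.
move=> h; apply/eqP; rewrite -subr_eq0 -nrm_eq0 -sqrf_eq0 -rdotxx rdotBl.
by rewrite h subrr.
Qed.

(** The tolerances are real because the norm takes its values in a field that is
    only partially ordered. *)
Definition converges u x :=
  forall e : R, 0 < e -> exists N, forall i, (N <= i)%N -> nrm (u i - x) < e.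

Lemma cauchy_converges u :
  (forall e : R, 0 < e -> exists N, forall i j, (N <= i)%N -> (N <= j)%N ->
    nrm (u i - u j) < e) -> exists x, converges u x.
Proof.
move=> cu; have cF : cauchy (u @ \oo).
  apply/cauchy_ballP => e e0.
  have re : e = (complex.Re e)%:C%C by rewrite RRe_real // gtr0_real.
  have e0' : 0 < complex.Re e by rewrite -ltcR -re.
  have [N hN] := cu _ e0'.
  exists (u @` [set i | (N <= i)%N], u @` [set i | (N <= i)%N]).
    by split; exists N => // i /= Ni; exists i.
  move=> [_ _] /= [[i Ni <-] [j Nj <-]].
  by rewrite -ball_normE /= normr_nrm re ltcR hN.
have /cvg_ex[x ux] : cvg (u @ \oo) by exact: cauchy_cvg.
 exists x => e e0.
have /cvgrPdist_lt/(_ e%:C%C) := ux; rewrite ltcR => /(_ e0) [N _ hN].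
by exists N => i /hN /=; rewrite normr_nrm ltcR nrmBC.
Qed.

Lemma converges_le u x c y : converges u x ->
  (forall i, nrm (u i - y) <= c) -> nrm (x - y) <= c.
Proof.
move=> ux uc; apply/ler_addgt0Pr => e /ux[N /(_ N (leqnn _))] h.
rewrite (addrC c) (le_trans (nrm_triangle (u N) _ _)) // nrmBC lerD //.
exact: ltW.
Qed.

Lemma converges_unique u x y : converges u x -> converges u y -> x = y.
Proof.
move=> ux uy; apply/eqP; rewrite -subr_eq0 -nrm_eq0 eq_le nrm_ge0 andbT.
apply/ler_addgt0Pr => e e0; rewrite add0r.
have [N hN] := ux _ (divr_gt0 e0 (ltr0Sn _ 1)); have [M hM] :=
  uy _ (divr_gt0 e0 (ltr0Sn _ 1)).
rewrite (le_trans (nrm_triangle (u (maxn N M)) _ _)) // nrmBC (splitr e).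
by rewrite lerD // ltW // ?hN ?hM ?leq_maxl ?leq_maxr.
Qed.

Lemma convergesD u v x y : converges u x -> converges v y ->
  converges (fun i => u i + v i) (x + y).
Proof.
move=> ux uy e e0.
have [N hN] := ux _ (divr_gt0 e0 (ltr0Sn _ 1)); have [M hM] :=
  uy _ (divr_gt0 e0 (ltr0Sn _ 1)).
exists (maxn N M) => i; rewrite geq_max => /andP[Ni Mi].
rewrite opprD addrACA (splitr e) (le_lt_trans (nrmD _ _)) // ltrD //.
  exact: hN.
exact: hM.
Qed.

Lemma converges_bounded (f : H -> H) c u x : {morph f : x y / x - y} ->
  (forall x, nrm (f x) <= c * nrm x) -> converges u x ->
  converges (fun i => f (u i)) (f x).
Proof.
move=> fB fc ux e e0.
have c0 : 0 < `|c| + 1 by rewrite ltr_wpDl.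
have [N hN] := ux _ (divr_gt0 e0 c0); exists N => i /hN h.
rewrite -fB (le_lt_trans (fc _)) //; move: h; rewrite ltr_pdivlMr // mulrC.
apply: le_lt_trans; rewrite ler_wpM2r ?nrm_ge0 // (le_trans (ler_norm _)) //.
by rewrite lerDl.
Qed.

Lemma converges_rdot u v x x' y y' : converges u x -> converges v x' ->
  (forall i, rdot (u i) y = rdot (v i) y') -> rdot x y = rdot x' y'.
Proof.
move=> ux vx uv; apply/eqP; rewrite -subr_eq0 -normr_eq0 eq_le normr_ge0 andbT.
apply/ler_addgt0Pr => e e0; rewrite add0r.
have c0 : 0 < nrm y + nrm y' + 1 by rewrite ltr_wpDl ?addr_ge0 ?nrm_ge0.
have [N hN] := ux _ (divr_gt0 e0 c0); have [M hM] := vx _ (divr_gt0 e0 c0).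
have := hN _ (leq_maxl N M); have := hM _ (leq_maxr N M).
move: (maxn N M) => i; set d := e / _ => h' h.
have -> : rdot x y - rdot x' y' = rdot (v i - x') y' - rdot (u i - x) y.
  by rewrite !rdotBl uv; ring.
rewrite (le_trans (ler_normB _ _)) //.
have := rdot_norm (v i - x') y'; have := rdot_norm (u i - x) y.
have := nrm_ge0 y; have := nrm_ge0 y'.
have : d * (nrm y + nrm y' + 1) = e by rewrite divfK // gt_eqF.
have : 0 < d by rewrite divr_gt0.
by nra.
Qed.

Lemma converges_cst x : converges (fun _ => x) x.
Proof. by move=> e e0; exists 0%N => i _; rewrite subrr nrm0. Qed.

Lemma converges_shift u x : converges u x -> converges (fun i => u i.+1) x.
Proof.
by move=> ux e /ux[N hN]; exists N => i Ni; apply: hN; exact: leqW.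
Qed.

End RealInnerProduct.

(** * Absolute value of a self-adjoint contraction *)

Section Operators.
Context {R : realType} {H : hilbert_space R}.
Local Open Scope ring_scope.
Implicit Types (x y z : H) (a b c : R) (f g : H -> H).

Lemma linear_fB f : linear f -> {morph f : x y / x - y}.
Proof.
by move=> fl x y; rewrite (addrC x) -scaleN1r fl scaleN1r (addrC (f x)).
Qed.

Lemma linear_f0 f : linear f -> f 0 = 0.
Proof. by move=> /linear_fB/(_ 0 0); rewrite !subrr. Qed.

Lemma linear_fD f : linear f -> {morph f : x y / x + y}.
Proof. by move=> fl x y; rewrite -[x]scale1r fl !scale1r. Qed.

Lemma linear_fZ f (a : R[i]) x : linear f -> f (a *: x) = a *: f x.
Proof. by move=> fl; rewrite -[a *: x]addr0 fl linear_f0 // addr0. Qed.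

Lemma linear_fsum f I (r : seq I) (F : I -> H) : linear f ->
  f (\sum_(i <- r) F i) = \sum_(i <- r) f (F i).
Proof. by move=> fl; apply: big_morph; [exact: linear_fD|exact: linear_f0]. Qed.

Lemma nrm_sum I (r : seq I) (F : I -> H) :
  nrm (\sum_(i <- r) F i) <= \sum_(i <- r) nrm (F i).
Proof.
elim/big_rec2: _ => [|i y x _ h]; first by rewrite nrm0.
by rewrite (le_trans (nrmD _ _)) // lerD2l.
Qed.

Definition contraction f := forall x, nrm (f x) <= nrm x.
Definition adjoint f g := forall x y, rdot (f x) y = rdot x (g y).

Section AbsoluteValue.
Variables (S : H -> H) (Sl : linear S) (Sc : contraction S) (Ss : adjoint S S).

Let X x := x - S (S x).

(** Iteration for [1 - |S|], the solution of [Y = (X + Y^2) / 2] with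
    [X = 1 - S^2].  Since [X] is a contraction, the increments are dominated by
    those of the same iteration for the number [1] in place of [X], that is
    [sqrt_bound], which is increasing and bounded by [1]. *)
Fixpoint sqrt_iter i x : H :=
  if i is j.+1 then (2^-1)%:C%C *: (X x + sqrt_iter j (sqrt_iter j x)) else 0.

Fixpoint sqrt_bound i : R :=
  if i is j.+1 then 2^-1 * (1 + sqrt_bound j ^+ 2) else 0.

Local Notation Y := sqrt_iter.
Local Notation b := sqrt_bound.

Let Xl : linear X.
Proof. by move=> a x y; rewrite /X !Sl scalerBr opprD addrACA. Qed.

Let Xc x : nrm (X x) <= nrm x.
Proof.
rewrite -(@ler_pXn2r _ 2) ?nnegrE ?nrm_ge0 // -!rdotxx /X.
rewrite !(rdotBl, rdotBr) (rdotC (S (S x))) -(Ss x) (rdotxx (S x)) rdotxx.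
rewrite (rdotxx (S _)).
have := Sc x; have := Sc (S x); have := nrm_ge0 (S x); have :=
  nrm_ge0 (S (S x)).
by nra.
Qed.

Let b01 i : 0 <= b i <= 1.
Proof.
elim: i => [|i /andP[h0 h1]] /=; first by rewrite lexx ler01.
by apply/andP; split; nra.
Qed.

Let b_mono i : b i <= b i.+1.
Proof.
elim: i => [|i IH]; first by have /andP[] := b01 1.
have /andP[h _] := b01 i; rewrite -[b i.+1]/(2^-1 * (1 + b i ^+ 2)).
rewrite -[b i.+2]/(2^-1 * (1 + b i.+1 ^+ 2)) ler_pM2l ?invr_gt0 // lerD2l.
by rewrite ler_pXn2r ?nnegrE // (le_trans h).
Qed.

Let Yl i : linear (Y i).
Proof.
elim: i => [|i IH] a x y /=; first by rewrite scaler0 addr0.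
rewrite Xl !IH scalerA (mulrC a) -scalerA -scalerDr; congr (_ *: _).
by rewrite addrACA -scalerDr.
Qed.

Let half_nrm x : nrm ((2^-1)%:C%C *: x) = 2^-1 * nrm x.
Proof. by rewrite nrmZ ger0_norm // invr_ge0. Qed.

Let Yc i x : nrm (Y i x) <= b i * nrm x.
Proof.
elim: i x => [|i IH] x; first by rewrite /= nrm0 mul0r.
rewrite [Y _ _]/= half_nrm [b _]/= -mulrA ler_pM2l ?invr_gt0 //.
rewrite (le_trans (nrmD _ _)) // mulrDl mul1r lerD ?Xc // expr2 -mulrA.
have /andP[bi _] := b01 i.
by rewrite (le_trans (IH _)) // ler_wpM2l ?IH.
Qed.

Let Y_step i x : nrm (Y i.+1 x - Y i x) <= (b i.+1 - b i) * nrm x.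
Proof.
elim: i x => [|i IH] x.
  by rewrite -[Y 0 x]/(0 : H) -[b 0]/(0 : R) !subr0 Yc.
rewrite -[Y i.+2 x]/((2^-1)%:C%C *: (X x + Y i.+1 (Y i.+1 x))).
rewrite -[X in _ - X]/((2^-1)%:C%C *: (X x + Y i (Y i x))) -scalerBr half_nrm.
rewrite opprD addrACA subrr add0r.
have -> : b i.+2 - b i.+1 = 2^-1 * (b i.+1 ^+ 2 - b i ^+ 2).
  by rewrite -mulrBr opprD addrACA subrr add0r.
rewrite -mulrA ler_pM2l ?invr_gt0 //; have /andP[bi _] := b01 i.+1.
rewrite (le_trans (nrm_triangle (Y i.+1 (Y i x)) _ _)) //.
rewrite -(linear_fB (Yl i.+1)) subr_sqr mulrDr mulrDl lerD //.
  rewrite (le_trans (Yc _ _)) // (mulrC (b i.+1 - b i)) -(mulrA (b i.+1)).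
  by rewrite ler_wpM2l ?IH.
by rewrite (le_trans (IH _)) // -(mulrA (b i.+1 - b i)) ler_wpM2l ?Yc //
  subr_ge0.
Qed.

Let Y_cauchy i j x : (i <= j)%N -> nrm (Y j x - Y i x) <= (b j - b i) * nrm x.
Proof.
move=> ij; rewrite -(subnKC ij); move: (j - i)%N => k {ij}.
elim: k => [|k IH]; first by rewrite addn0 !subrr nrm0 mul0r.
rewrite addnS (le_trans (nrm_triangle (Y (i + k) x) _ _)) //.
rewrite (le_trans (lerD (Y_step _ _) IH)) // -mulrDl.
by rewrite addrA subrK.
Qed.

Let Y_converges x : exists y, converges (Y^~ x) y.
Proof.
apply: cauchy_converges => e e0.
have nx : 0 < nrm x + 1 by rewrite ltr_wpDl ?nrm_ge0.
have hs : has_sup (range b).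
  by split; [exists (b 0%N), 0%N|exists 1 => _ [i _ <-]; have /andP[] := b01 i].
have e1 : 0 < e / (nrm x + 1) by rewrite divr_gt0.
have [_ [N _ <-] hN] := sup_adherent e1 hs.
have key i j : (N <= i)%N -> (i <= j)%N -> nrm (Y j x - Y i x) < e.
  move=> Ni ij; rewrite (le_lt_trans (Y_cauchy _ ij)) //.
  have bmono : {homo b : i j / (i <= j)%N >-> i <= j}.
    by apply: homo_leq => // ? ? ?; exact: le_trans.
  have hj : b j <= sup (range b) by apply: sup_upper_bound => //; exists j.
  have hi := bmono _ _ Ni.
  have : b j - b i < e / (nrm x + 1) by lra.
  rewrite ltr_pdivlMr //; apply: le_lt_trans.
  by rewrite ler_wpM2l ?lerDl // subr_ge0; exact: bmono.
exists N => i j Ni Nj; have [ij|/ltnW ji] := leqP i j; last exact: key.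
by rewrite nrmBC; exact: key.
Qed.

Let Y_comm f : linear f -> (forall x, f (S x) = S (f x)) ->
  forall i x, f (Y i x) = Y i (f x).
Proof.
move=> fl fS; elim=> [|i IH] x /=; first exact: linear_f0.
by rewrite linear_fZ // linear_fD // !IH /X linear_fB // !fS.
Qed.

Let Y_adj i : adjoint (Y i) (Y i).
Proof.
elim: i => [|i IH] x y /=; first by rewrite rdot0l rdot0r.
by rewrite rdotZl rdotZr rdotDl rdotDr !IH /X rdotBl rdotBr !Ss.
Qed.

Lemma absolute_value : exists Z : H -> H,
  [/\ linear Z, adjoint Z Z, forall x, Z (Z x) = S (S x),
   forall x, 0 <= rdot (Z x) x &
   forall f c, linear f -> (forall x, nrm (f x) <= c * nrm x) ->
     (forall x, f (S x) = S (f x)) -> forall x, f (Z x) = Z (f x)].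
Proof.
have [V hV] := choice Y_converges.
have Vc x : nrm (V x) <= nrm x.
  rewrite -[V x]subr0; apply: converges_le (hV x) _ => i; rewrite subr0.
  by rewrite (le_trans (Yc i x)) // ler_piMl ?nrm_ge0 //; have /andP[] := b01 i.
have Vl : linear V.
  move=> a x y; apply: converges_unique (hV _) _.
  have -> : (fun i => Y i (a *: x + y)) = (fun i => a *: Y i x + Y i y).
    by apply/funext => i; rewrite Yl.
  apply: convergesD (hV y).
  apply: (converges_bounded (f := fun z => a *: z) (c :=
    complex.Re `|a|)) (hV x).
    by move=> u v; rewrite scalerBr.
  by move=> u; rewrite nrmZc.
have Vadj : adjoint V V.
  move=> x y; rewrite (rdotC x); apply: converges_rdot (hV x) (hV y) _ => i.
  by rewrite Y_adj rdotC.
have V2 x : V x = (2^-1)%:C%C *: (X x + V (V x)).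
  apply: converges_unique (converges_shift (hV x)) _.
  apply: (converges_bounded (f := fun z => (2^-1)%:C%C *: z) (c := 2^-1)).
  - by move=> u v; rewrite scalerBr.
  - by move=> u; rewrite half_nrm.
  apply: convergesD (converges_cst _) _ => e e0.
  have e2 : 0 < e / 2 by rewrite divr_gt0.
  have [N hN] := hV x _ e2; have [M hM] := hV (V x) _ e2.
  exists (maxn N M) => i; rewrite geq_max => /andP[/hN hi /hM hi'].
  rewrite (le_lt_trans (nrm_triangle (Y i (V x)) _ _)) // (splitr e) ltrD //.
  rewrite -(linear_fB (Yl i)) (le_lt_trans _ hi) // (le_trans (Yc i _)) //.
  by rewrite ler_piMl ?nrm_ge0 //; have /andP[] := b01 i.
have V22 x : V x + V x = X x + V (V x).
  rewrite [in LHS]V2 -scalerDl -rmorphD /= (_ : 2^-1 + 2^-1 = 1) ?scale1r //.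
  by field.
exists (fun x => x - V x); split.
- by move=> a x y; rewrite Vl scalerBr opprD addrACA.
- by move=> x y; rewrite rdotBl rdotBr Vadj.
- move=> x; rewrite (linear_fB Vl) opprB addrA (addrAC x) -(addrA (x + _)).
  by rewrite -opprD V22 opprD addrACA subrr addr0 /X opprB addrC subrK.
- move=> x; rewrite rdotBl subr_ge0 (le_trans (rdot_le _ _)) // rdotxx expr2.
  by rewrite ler_wpM2r ?nrm_ge0.
move=> f c fl fc fS x; rewrite linear_fB //; congr (_ - _).
apply: converges_unique (hV _).
have -> : Y^~ (f x) = (fun i => f (Y i x)) by apply/funext => i; rewrite Y_comm.
by apply: converges_bounded (hV x); [exact: linear_fB|exact: fc].
Qed.

End AbsoluteValue.
End Operators.

(** * Commuting families of operators *)

Section Schur.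
Context {R : realType} {H : hilbert_space R}.
Local Open Scope ring_scope.
Implicit Types (x y z u w e : H) (a b c l : R) (f g S P : H -> H).

(** If every shift [S - l] were semidefinite on the vectors fixed by [P], then
    for [l] the Rayleigh quotient of [e] its quadratic form would vanish there,
    and so would [S - l] by polarization. *)
Lemma indefinite_shift S P e : linear S -> adjoint S S -> linear P ->
  (forall x, P (S x) = S (P x)) -> P e = e -> e != 0 ->
  (forall l, exists2 x, P x = x & S x != l%:C%C *: x) ->
  exists l x1 x2, [/\ P x1 = x1, P x2 = x2,
    rdot (S x1) x1 < l * rdot x1 x1 & l * rdot x2 x2 < rdot (S x2) x2].
Proof.
move=> Sl Ss Pl PS Pe e0 nS; apply: contrapT => no.
have qe : 0 < rdot e e by exact: rdotxx_gt0.
pose l := rdot (S e) e / rdot e e.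
have le : rdot (S e) e = l * rdot e e by rewrite divfK // gt_eqF.
have q x : P x = x -> rdot (S x) x = l * rdot x x.
  move=> Px; apply/eqP; rewrite eq_le !leNgt; apply/andP; split;
    apply/negP => lt.
    have x0 : x != 0 by apply: contraTneq lt => ->; rewrite !rdot0r mulr0 ltxx.
    have qx := rdotxx_gt0 x0; rewrite -ltr_pdivlMr // in lt.
    apply: no; exists ((l + rdot (S x) x / rdot x x) / 2), e, x; split => //.
      by rewrite le ltr_pM2r // midf_lt.
    by rewrite -ltr_pdivlMr // midf_lt.
  have x0 : x != 0 by apply: contraTneq lt => ->; rewrite !rdot0r mulr0 ltxx.
  have qx := rdotxx_gt0 x0; rewrite -ltr_pdivrMr // in lt.
  apply: no; exists ((rdot (S x) x / rdot x x + l) / 2), x, e; split => //.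
    by rewrite -ltr_pdivrMr // midf_lt.
  by rewrite le ltr_pM2r // midf_lt.
have [x Px] := nS l; rewrite -subr_eq0 => /negP[].
have [y ey] : exists y, S x - l%:C%C *: x = y by eexists.
rewrite ey; have Py : P y = y by rewrite -ey linear_fB // PS linear_fZ // Px.
have Pxy : P (x + y) = x + y by rewrite linear_fD // Px Py.
have := q _ Pxy; rewrite linear_fD // !(rdotDl, rdotDr) (q x Px) (q y Py).
rewrite (rdotC (S y)) -Ss (rdotC y x) => h.
have : rdot y y = 0 by rewrite -{1}ey rdotBl rdotZl; lra.
by move=> /eqP; rewrite rdotxx sqrf_eq0 nrm_eq0.
Qed.

(** Scale an indefinite shift of [S] to a contraction [S1].  Neither of
    [|S1| - S1] and [|S1| + S1] vanishes, their product does, and both commute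
    with whatever commutes with [S]; so [u] and [w] can be taken in their
    respective ranges. *)
Lemma nonscalar_orthogonal S P e c : linear S -> adjoint S S ->
  (forall x, nrm (S x) <= c * nrm x) -> linear P -> contraction P ->
  (forall x, P (S x) = S (P x)) -> P e = e -> e != 0 ->
  (forall l, exists2 x, P x = x & S x != l%:C%C *: x) ->
  exists u w, [/\ u != 0, w != 0, P u = u, P w = w &
   forall f, linear f -> contraction f -> (forall x, f (S x) = S (f x)) ->
     hdot H (f w) u = 0].
Proof.
move=> Sl Ss Sc Pl Pc PS Pe e0 nS.
have [l [x1 [x2 [Px1 Px2 lx1 lx2]]]] := indefinite_shift Sl Ss Pl PS Pe e0 nS.
pose d := (`|c| + `|l| + 1)^-1; have c0 :
  0 < `|c| + `|l| + 1 by rewrite ltr_wpDl ?addr_ge0.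
have d0 : 0 < d by rewrite invr_gt0.
pose S1 x := d%:C%C *: (S x - l%:C%C *: x).
have S1l : linear S1.
  move=> a x y; rewrite /S1 Sl scalerA (mulrC a) -scalerA -scalerDr.
  congr (_ *: _); rewrite scalerBr addrACA scalerDr opprD !scalerA (mulrC a).
  by [].
have S1a : adjoint S1 S1.
  by move=> x y; rewrite /S1 rdotZl rdotZr rdotBl rdotBr rdotZl rdotZr Ss.
have S1c : contraction S1.
  move=> x; rewrite /S1 nrmZ gtr0_norm // mulrC ler_pdivrMr //.
  rewrite (le_trans (nrmB _ _)) // nrmZ.
  have := Sc x; have := ler_norm c; have := nrm_ge0 x; nra.
have S1comm f : linear f -> (forall x, f (S x) = S (f x)) ->
    forall x, f (S1 x) = S1 (f x).
  by move=> fl fS x; rewrite /S1 linear_fZ // linear_fB // linear_fZ // fS.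
have [Z [Zl Za Z2 Z0 Zcomm]] := absolute_value S1l S1c S1a.
have c1 f : contraction f -> forall x, nrm (f x) <= 1 * nrm x.
  by move=> fc x; rewrite mul1r.
have ZS x : S1 (Z x) = Z (S1 x) by apply: (Zcomm S1 1) => //; exact: c1.
have ortho y : rdot (Z y + S1 y) (Z x1 - S1 x1) = 0.
  rewrite !(rdotDl, rdotBr) -!Za -!S1a ZS Z2; ring.
have PS1 := S1comm P Pl PS.
exists (Z x1 - S1 x1), (Z x2 + S1 x2); split.
- apply/eqP => /(congr1 (fun y => rdot y x1)); rewrite rdot0l rdotBl.
  have := Z0 x1; rewrite /S1 rdotZl rdotBl rdotZl; nra.
- apply/eqP => /(congr1 (fun y => rdot y x2)); rewrite rdot0l rdotDl.
  have := Z0 x2; rewrite /S1 rdotZl rdotBl rdotZl; nra.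
- by rewrite linear_fB // (Zcomm P 1 Pl (c1 P Pc) PS1) PS1 Px1.
- by rewrite linear_fD // (Zcomm P 1 Pl (c1 P Pc) PS1) PS1 Px2.
move=> f fl fc fS; have fS1 := S1comm f fl fS.
have -> : f (Z x2 + S1 x2) = Z (f x2) + S1 (f x2).
  by rewrite linear_fD // (Zcomm f 1 fl (c1 f fc) fS1) fS1.
rewrite -(linear0l (hdot H) (Z x1 - S1 x1)); apply: hdot_eq.
  by rewrite ortho rdot0l.
by rewrite scaler0 rdot0l scalerDr -(linear_fZ _ _ Zl) -(linear_fZ _ _ S1l)
  ortho.
Qed.

Lemma adjoint_sym f g : adjoint f g -> adjoint g f.
Proof. by move=> fg x y; rewrite rdotC -fg rdotC. Qed.

Lemma rdot_i_skew x y : rdot ('i%C *: x) y = - rdot x ('i%C *: y).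
Proof.
by rewrite -rdot_ii scalerA -expr2 sqr_i scaleN1r rdotNl rdotC rdotC.
Qed.

(** For [g] the adjoint of [f], the operators [f + g] and [i (f - g)] are
    self-adjoint.  If they are all scalar on the vectors fixed by [P], then so
    are all the [f], and orthogonal vectors will do.  Otherwise
    [nonscalar_orthogonal] applies to one of them. *)
Lemma commuting_reducible (A : set (H -> H)) P e e' :
  (forall f, A f -> linear f) -> (forall f, A f -> contraction f) ->
  (forall f, A f -> exists2 g, A g & adjoint f g) ->
  (forall f g, A f -> A g -> forall x, f (g x) = g (f x)) ->
  A P -> P e = e -> P e' = e' -> e != 0 -> (forall c : R[i], e' != c *: e) ->
  exists u w, [/\ u != 0, w != 0, P u = u, P w = w &
    forall f, A f -> hdot H (f w) u = 0].
Proof.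
move=> Al Ac Aadj Acomm AP Pe Pe' e0 ee'; apply: contrapT => no.
have scalar S : linear S -> adjoint S S -> (forall x, nrm (S x) <= 2 * nrm x) ->
    (forall f, A f -> forall x, f (S x) = S (f x)) ->
    exists l, forall x, P x = x -> S x = l%:C%C *: x.
  move=> Sl Sa Sc Scomm; apply: contrapT => nS; apply: no.
  have [|u [w [u0 w0 Pu Pw uw]]] := @nonscalar_orthogonal S P e 2 Sl Sa Sc
    (Al P AP) (Ac P AP) (Scomm P AP) Pe e0.
    move=> l; apply: contrapT => h; apply: nS; exists l => x Px.
    by apply: contrapT => /eqP Sx; apply: h; exists x.
  exists u, w; split=> // f Af.
  exact: uw (Al f Af) (Ac f Af) (Scomm f Af).
pose u := e' - (hdot H e' e / hdot H e e) *: e.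
have de : hdot H e e != 0 by rewrite hdot_norm sqrf_eq0 normr_eq0.
have eu : hdot H e u = 0.
  by rewrite hdotC /u -scaleN1r addrC hdotDl !hdotZl mulN1r divfK // addrC
    subrr conjc0.
apply: no; exists u, e; split=> //.
- by rewrite /u subr_eq0 ee'.
- have Pl := Al P AP; by rewrite /u (linear_fB Pl) (linear_fZ _ _ Pl) Pe Pe'.
move=> f Af; have [g Ag fg] := Aadj f Af; have gf := adjoint_sym fg.
have [fl gl] := (Al f Af, Al g Ag); have [fc gc] := (Ac f Af, Ac g Ag).
have [||||l hl] := scalar (fun x => f x + g x).
- by move=> a x y; rewrite fl gl scalerDr addrACA.
- by move=> x y; rewrite rdotDl rdotDr fg gf addrC.
- move=> x; rewrite (le_trans (nrmD _ _)) //; have := fc x; have := gc x; lra.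
- by move=> h Ah x; rewrite (linear_fD (Al h Ah)) (Acomm h f Ah Af) (Acomm h g
  Ah Ag).
have [||||m hm] := scalar (fun x => 'i%C *: (f x - g x)).
- move=> a x y; rewrite fl gl scalerA (mulrC a) -scalerA -scalerDr;
  congr (_ *: _).
  by rewrite opprD addrACA scalerBr.
- move=> x y; rewrite rdot_i_skew rdotBl fg gf -rdotBr -rdotNr opprB.
  by rewrite (linear_fZ _ _ fl) (linear_fZ _ _ gl) scalerBr.
- move=> x; rewrite nrmi (le_trans (nrmB _ _)) //; have := fc x; have :=
  gc x; lra.
- move=> h Ah x.
  by rewrite (linear_fZ _ _ (Al h Ah)) (linear_fB (Al h Ah)) (Acomm h f Ah Af)
    (Acomm h g Ah Ag).
have := congr1 (fun y => hdot H y u) (hl e Pe).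
have := congr1 (fun y => hdot H y u) (hm e Pe).
rewrite /= !hdotZl eu !mulr0 hdotDl => /eqP; rewrite mulf_eq0 => /orP[/eqP[]|].
  by move=> /eqP; rewrite oner_eq0.
rewrite -scaleN1r hdotDl hdotZl mulN1r subr_eq0 => /eqP <-.
by move=> /eqP; rewrite -mulr2n mulrn_eq0 => /eqP.
Qed.

End Schur.

(** * The mean ergodic theorem *)

Section MeanErgodic.
Context {R : realType} {H : hilbert_space R}.
Local Open Scope ring_scope.
Implicit Types (x y z : H) (e : R).
Variables (T : H -> H) (Tl : linear T) (Tn : forall x, nrm (T x) = nrm x).

Definition average N x : H := (N.+1%:R^-1)%:C%C *: \sum_(j < N.+1) iter j T x.
Local Notation M := average.

Let iter_linear j : linear (iter j T).
Proof. by elim: j => [//|j IH] a x y; rewrite !iterS IH Tl. Qed.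

Let iter_nrm j x : nrm (iter j T x) = nrm x.
Proof. by elim: j => //= j IH; rewrite Tn. Qed.

Let inv_ge0 N : 0 <= (N.+1%:R^-1 : R). Proof. by rewrite invr_ge0 ler0n. Qed.

Lemma average_linear N : linear (M N).
Proof.
move=> a x y; rewrite /M scalerA (mulrC a) -scalerA -scalerDr; congr (_ *: _).
by rewrite scaler_sumr -big_split; apply: eq_bigr => j _; rewrite iter_linear.
Qed.

Let mean_le N (F : 'I_N.+1 -> H) c : (forall j, nrm (F j) <= c) ->
  nrm ((N.+1%:R^-1)%:C%C *: \sum_j F j) <= c.
Proof.
move=> Fc; rewrite nrmZ ger0_norm // mulrC ler_pdivrMr ?ltr0n //.
rewrite (le_trans (nrm_sum _ _)) // (le_trans (ler_sum _ (fun j _ => Fc j))) //.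
by rewrite sumr_const card_ord mulr_natr.
Qed.

Lemma average_contraction N : contraction (M N).
Proof. by move=> x; apply: mean_le => j; rewrite iter_nrm. Qed.

Let average_T N x : nrm (M N (T x) - M N x) <= 2 * nrm x / N.+1%:R.
Proof.
rewrite /M -scalerBr nrmZ ger0_norm // mulrC ler_wpM2r //.
have -> : \sum_(j < N.+1) iter j T (T x) - \sum_(j < N.+1) iter j T x =
    iter N.+1 T x - x.
  have e : x + \sum_(j < N.+1) iter j T (T x) =
      \sum_(j < N.+1) iter j T x + iter N.+1 T x.
    transitivity (\sum_(j < N.+2) iter j T x); last by rewrite big_ord_recr.
    by rewrite [RHS]big_ord_recl; congr (_ + _); apply: eq_bigr => j _;
      rewrite lift0 iterSr.
  by rewrite -[X in X - _](addKr x) e -addrA [X in X - _]addrC addrK addrC.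
rewrite (le_trans (nrmB _ _)) // iter_nrm; lra.
Qed.

Let average_iter N i x :
  nrm (M N (iter i T x) - M N x) <= i%:R * (2 * nrm x / N.+1%:R).
Proof.
elim: i => [|i IH]; first by rewrite subrr nrm0 mul0r.
rewrite (le_trans (nrm_triangle (M N (iter i T x)) _ _)) // mulrSr mulrDl mul1r.
by rewrite addrC lerD // iterS (le_trans (average_T _ _)) // iter_nrm.
Qed.

Let average_average N L x :
  nrm (M N (M L x) - M N x) <= L%:R * (2 * nrm x / N.+1%:R).
Proof.
have NL := average_linear N.
have -> : M N (M L x) - M N x = (L.+1%:R^-1)%:C%C *:
    \sum_(i < L.+1) (M N (iter i T x) - M N x).
  rewrite {2}/M (linear_fZ _ _ NL) (linear_fsum _ _ NL) sumrB scalerBr.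
  congr (_ - _); rewrite sumr_const card_ord -(scaler_nat L.+1 (M N x)) scalerA.
  have -> : (L.+1%:R : R[i]) = (L.+1%:R)%:C%C by rewrite rmorph_nat.
  by rewrite -rmorphM mulVf ?pnatr_eq0 // scale1r.
apply: mean_le => i; rewrite (le_trans (average_iter _ _ _)) //.
rewrite ler_wpM2r ?mulr_ge0 ?nrm_ge0 // ler_nat -ltnS; exact: ltn_ord.
Qed.

Let average_near L x e : 0 < e -> exists N0, forall N, (N0 <= N)%N ->
  nrm (M N (M L x) - M N x) < e.
Proof.
move=> e0; set C := L%:R * (2 * nrm x).
have C0 : 0 <= C / e by rewrite divr_ge0 ?mulr_ge0 ?nrm_ge0 // ltW.
exists (Num.Def.archi_bound (C / e)) => N hN.
rewrite (le_lt_trans (average_average _ _ _)) // mulrA ltr_pdivrMr ?ltr0n //.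
rewrite (mulrC e) -ltr_pdivrMr // (lt_le_trans (archi_boundP C0)) // ler_nat.
exact: leqW.
Qed.

(** Riesz's argument: averages of averages are again close to averages, so
    averages of nearly minimal norm are close to each other by the
    parallelogram law. *)
Let average_cauchy x e : 0 < e -> exists N, forall i j, (N <= i)%N ->
  (N <= j)%N ->
  nrm (M i x - M j x) < e.
Proof.
move=> e0; pose A := range (fun N => nrm (M N x)); pose d := inf A.
have hA : has_inf A.
  by split; [exists (nrm (M 0 x)), 0%N|exists 0 => _ [N _ <-]; exact: nrm_ge0].
have dle N : d <= nrm (M N x) by apply: (ge_inf hA.2); exists N.
have d0 : 0 <= d by apply: (lb_le_inf hA.1) => _ [N _ <-]; exact: nrm_ge0.
(* so that [4 (d + 2 t)^2 - 4 d^2 = 16 t (d + t)] is less than [e^2] *)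
pose t := Num.min 1 (e ^+ 2 / (16 * d + 17)).
have q0 : 0 < 16 * d + 17 by lra.
have t0 : 0 < t by rewrite lt_min ltr01 divr_gt0 // exprn_gt0.
have t1 : t <= 1 by rewrite ge_min lexx.
have te : t * (16 * d + 17) <= e ^+ 2.
  by rewrite -ler_pdivlMr // ge_min lexx orbT.
have [_ [L _ <-] hL] := inf_adherent t0 hA.
have [N0 hN0] := average_near L x t0.
have small N : (N0 <= N)%N -> nrm (M N x) < d + 2 * t.
  move=> /hN0 h; have := nrm_triangle (M N (M L x)) (M N x) 0.
  rewrite !subr0 nrmBC; have := average_contraction N (M L x); lra.
exists N0 => i j /small hi /small hj.
have mid : 2 * d <= nrm (M i x + M j x).
  apply/ler_addgt0Pr => s s0; have s2 : 0 < s / 2 by rewrite divr_gt0.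
  have [N1 h1] := average_near i x s2; have [N2 h2] := average_near j x s2.
  have := h1 _ (leq_maxl N1 N2); have := h2 _ (leq_maxr N1 N2).
  move: (maxn N1 N2) => N {}h2 {}h1.
  have := average_contraction N (M i x + M j x).
  rewrite (linear_fD (average_linear N)).
  have -> : M N (M i x) + M N (M j x) = (M N x + M N x) -
      ((M N x - M N (M i x)) + (M N x - M N (M j x))).
    by rewrite opprD !opprB addrACA !(addrCA (M N x)) subrr !addr0.
  set p := M N x + M N x; set q := _ + (M N x - _) => hc.
  have hq : nrm q <= s.
    rewrite (le_trans (nrmD _ _)) // nrmBC (nrmBC (M N x)); lra.
  have hp : 2 * d <= nrm p.
    have -> : p = 2%:C%C *: M N x.
      by rewrite /p -[X in X + X]scale1r -scalerDl -rmorphD.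
    by rewrite nrmZ ger0_norm // ler_pM2l.
  have := nrm_triangle (p - q) p 0; rewrite !subr0 opprB addrCA subrr addr0;
    lra.
rewrite -(@ltr_pXn2r _ 2) ?nnegrE ?nrm_ge0 ?(ltW e0) //.
have : nrm (M i x - M j x) ^+ 2 =
    2 * nrm (M i x) ^+ 2 + 2 * nrm (M j x) ^+ 2 - nrm (M i x + M j x) ^+ 2.
  by rewrite -!rdotxx !(rdotBl, rdotBr, rdotDl, rdotDr) (rdotC (M j x)); ring.
have := nrm_ge0 (M i x); have := nrm_ge0 (M j x); nra.
Qed.

Lemma mean_ergodic : exists P : H -> H, [/\ linear P, contraction P,
  forall x, T (P x) = P x, forall x, T x = x -> P x = x &
  forall x, converges (average^~ x) (P x)].
Proof.
have [P hP] := choice (fun x => cauchy_converges (@average_cauchy x)).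
exists P; split=> //.
- move=> a x y; apply: converges_unique (hP _) _.
  have -> : M^~ (a *: x + y) = (fun i => a *: M i x + M i y).
    by apply/funext => i; rewrite average_linear.
  apply: convergesD (hP y).
  apply: (converges_bounded (f := fun z => a *: z) (c :=
    complex.Re `|a|)) (hP x).
    by move=> u v; rewrite scalerBr.
  by move=> u; rewrite nrmZc.
- move=> x; rewrite -[P x]subr0; apply: converges_le (hP x) _ => i.
  by rewrite subr0 average_contraction.
- move=> x; apply: (@converges_unique _ _ (fun i => T (M i x))).
    apply: (converges_bounded (c := 1)) (hP x); first exact: linear_fB.
    by move=> u; rewrite Tn mul1r.
  have TM i : T (M i x) = M i (T x).
    rewrite /M (linear_fZ _ _ Tl) (linear_fsum _ _ Tl); congr (_ *: _).
    by apply: eq_bigr => j _; rewrite -iterS iterSr.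
  move=> e e0; have e2 : 0 < e / 2 by rewrite divr_gt0.
  have [N hN] := hP x _ e2; have [L hL] : exists L, forall i, (L <= i)%N ->
      2 * nrm x / i.+1%:R < e / 2.
    have C0 : 0 <= 2 * nrm x / (e / 2) by rewrite divr_ge0 ?mulr_ge0 ?nrm_ge0
      // ltW.
    exists (Num.Def.archi_bound (2 * nrm x / (e / 2))) => i hi.
    rewrite ltr_pdivrMr ?ltr0n // (mulrC (e / 2)) -ltr_pdivrMr //.
    by rewrite (lt_le_trans (archi_boundP C0)) // ler_nat leqW.
  exists (maxn N L) => i; rewrite geq_max => /andP[/hN h /hL h'].
  have := nrm_triangle (M i x) (M i (T x)) (P x); have := average_T i x.
  by rewrite TM /=; move: (2 * nrm x / i.+1%:R) h' => r h'; lra.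
move=> x Tx; apply: converges_unique (hP x) _.
have -> : M^~ x = fun=> x; last exact: converges_cst.
apply/funext => N; rewrite /M (eq_bigr (fun=> x)) => [|j _]; last first.
  by elim: (j : nat) => //= k ->.
rewrite sumr_const card_ord -(scaler_nat N.+1 x) scalerA.
have -> : (N.+1%:R : R[i]) = (N.+1%:R)%:C%C by rewrite rmorph_nat.
by rewrite -rmorphM mulVf ?pnatr_eq0 // scale1r.
Qed.

Lemma ergodic_rdot P x y x' y' : (forall x, converges (average^~ x) (P x)) ->
  (forall j, rdot (iter j T x) y = rdot x' (iter j T y')) ->
  rdot (P x) y = rdot x' (P y').
Proof.
move=> hP h; rewrite (rdotC x'); apply: converges_rdot (hP x) (hP y') _ => N.
have sum_rdot (F : 'I_N.+1 -> H) z : rdot (\sum_j F j) z = \sum_j rdot (F j) z.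
  apply: (big_morph (fun x => rdot x z)) => [u v|]; [exact: rdotDl|exact:
    rdot0l].
rewrite /M !rdotZl !sum_rdot; congr (_ * _).
by apply: eq_bigr => j _; rewrite h rdotC.
Qed.

End MeanErgodic.

(** * Vectors fixed by the automorphism group *)

Section Spherical.
Context {n : nat} {T : regular_tree n} {R : realType} {H : hilbert_space R}.
Variable rho : unitary_rep (hier T) H.
Local Open Scope ring_scope.
Implicit Types (x y z : T) (g h q : hier T) (k t u : aut T) (v w xi zeta : H).

Lemma rep_linear g : linear (rho g).
Proof. exact: linearP. Qed.

Lemma rep_rdot g v w : rdot (rho g v) (rho g w) = rdot v w.
Proof. by rewrite /rdot rep_unitary. Qed.

Lemma rep_nrm g v : nrm (rho g v) = nrm v.
Proof.
by apply/eqP; rewrite -(@eqrXn2 _ 2) ?nrm_ge0 // -!rdotxx rep_rdot.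
Qed.

Lemma repK g v : rho g^-1%g (rho g v) = v.
Proof. by rewrite -repM mulVg rep1. Qed.

Lemma repVK g v : rho g (rho g^-1%g v) = v.
Proof. by rewrite -repM mulgV rep1. Qed.

Lemma rep_adjoint g : adjoint (rho g) (rho g^-1%g).
Proof. by move=> v w; rewrite -(rep_rdot g v) repVK. Qed.

Lemma rep_expg t j v : rho (\d (t ^+ j)%g) v = iter j (rho (\d t)) v.
Proof.
elim: j => [|j IH]; first by rewrite expg0 hier_of_aut1 rep1.
by rewrite expgS hier_of_autM repM IH.
Qed.

(** The iterates of [y] under [t^-1] form a way, which leaves every vertex
    behind. *)
Lemma translate_absorbs t x y (F : set T) : translates t x y -> finite_set F ->
  exists j, forall z, F z -> branch x y ((t ^+ j : aut T)%g z).
Proof.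
move=> txy /finite_fsetP[X ->].
have tyx := translatesV txy; pose a := orbit_way tyx.
have [N hN] := choice (way_behind a).
pose j := (\max_(z <- X) N z)%N; exists j => z /= zX.
have /hN : (N z <= j)%N by exact: leq_bigmax_seq.
have [_ tV _] := tyx.
have aE i z' : (t ^+ i : aut T)%g (iter i (t^-1 : aut T)%g z') = z'.
  elim: i z' => [|i IH] z'; first by rewrite expg0.
  by rewrite expgSr iterS -[LHS]/((t ^+ i : aut T)%g (t ((t^-1 :
    aut T)%g _))) autVK.
rewrite -[a j.+1]/(iter j.+1 _ y) iterSr tV -[a j]/(iter j _ y).
by move=> /(branch_aut (t ^+ j)%g); rewrite !aE.
Qed.

(** Mautner's phenomenon: conjugating [u] by powers of [t] contracts it to the
    identity, while a vector fixed by [t] does not notice the conjugation. *)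
Lemma mautner t x y u v : translates t x y -> rho (\d t) v = v ->
  (forall z, branch x y z -> u z = z) -> rho (\d u) v = v.
Proof.
move=> txy tv ub; apply/esym/eqP;
  rewrite -subr_eq0 -nrm_eq0 eq_le nrm_ge0 andbT.
apply/ler_addgt0Pr => e e0; rewrite add0r.
have /cvgrPdist_lt/(_ e%:C%C) := @rep_continuous _ _ _ rho v 1%g.
rewrite ltcR => /(_ e0)/nbhs_hier[F fF hF].
have [j hj] := translate_absorbs txy fF.
have kF : stabilizer F (t ^- j * (u * t ^+ j))%g.
  move=> z /hj /ub uz.
  by rewrite -[LHS]/((t ^- j : aut T)%g (u ((t ^+ j : aut T)%g z))) uz autK.
have := hF _ kF; rewrite mul1g rep1 normr_nrm ltcR => /ltW.
have jv i : iter i (rho (\d t)) v = v by elim: i => //= i ->.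
rewrite !hier_of_autM !repM rep_expg jv -(rep_nrm (\d (t ^+ j)%g)) linearB.
by rewrite rep_expg jv hier_of_autV repVK.
Qed.

(** [mautner], for [t] and for its inverse, is what [aut_generated] asks of the
    stabilizer of [v]. *)
Lemma fixed_by_translation t x y v : (1 < n)%N -> translates t x y ->
  rho (\d t) v = v -> forall k, rho (\d k) v = v.
Proof.
move=> n1 txy tv.
have tv' : rho (\d t^-1%g) v = v by rewrite -{1}tv hier_of_autV repK.
apply: (aut_generated (L := [set k | rho (\d k) v = v]) n1 _ _ txy tv) => /=.
- by move=> g k gv kv; rewrite hier_of_autM repM kv.
- by move=> g gv; rewrite -{1}gv hier_of_autV repK.
- by move=> g; exact: mautner txy tv.
- by move=> g; exact: mautner (translatesV txy) tv'.
Qed.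

Lemma hdot_adjoint (f f' : H -> H) v w : linear f -> adjoint f f' ->
  hdot H (f v) w = hdot H v (f' w).
Proof.
move=> fl ff'; apply: hdot_eq; first exact: ff'.
by rewrite -(linear_fZ _ _ fl) ff'.
Qed.

(** [P] is given by the mean ergodic theorem for [t].  Multiplying [g] by
    automorphisms on either side does not change [P rho(g) P], so [g] and [h]
    may be supposed trivial on complementary balls; then [g] commutes with all
    [t^j h t^-j], and the average over [j] is the commutation sought. *)
Lemma spherical_operators : (1 < n)%N -> exists P : H -> H,
  [/\ linear P, contraction P & adjoint P P] /\
  [/\ forall v k, rho (\d k) (P v) = P v,
   forall v, (forall k, rho (\d k) v = v) -> P v = v &
   forall g h v, P (rho g (P (rho h (P v)))) = P (rho h (P (rho g (P v))))].
Proof.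
move=> n1; have [t [x [y txy]]] := translation_exists (T := T) (ltnW n1).
have yx : adj y x by case: txy; rewrite adj_sym.
have [P [Pl Pc TP Pfix hP]] := mean_ergodic (rep_linear (\d t)) (rep_nrm (\d
  t)).
have KP v k : rho (\d k) (P v) = P v by apply:
  fixed_by_translation txy (TP v) k.
have Pproj v w : (forall k, rho (\d k) w = w) -> rdot (P v) w = rdot v w.
  move=> wK; rewrite -{2}(Pfix w (wK t)); apply: ergodic_rdot hP _ => j.
  by rewrite -!rep_expg rep_adjoint -hier_of_autV !wK.
have Pa : adjoint P P.
  move=> v w; rewrite rdotC -(Pproj w (P v) (KP v)) rdotC.
  exact: Pproj v (P w) (KP w).
have PK k v : P (rho (\d k) v) = P v.
  by apply: rdot_ext => z; rewrite !Pa rep_adjoint -hier_of_autV KP.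
have comm g h : (forall e, ball (branch x y) e -> g e = e) ->
    (forall e, ball (branch y x) e -> h e = e) ->
    forall v, P (rho g (P (rho h (P v)))) = P (rho h (P (rho g (P v)))).
  move=> gid hid v; apply: rdot_ext => z.
  rewrite !Pa rep_adjoint [RHS]rep_adjoint [RHS]Pa.
  apply: ergodic_rdot hP _ => j; rewrite -!rep_expg.
  have c : rho g (rho (\d (t ^+ j)%g) (rho h (P v))) =
      rho (\d (t ^+ j)%g) (rho h (rho (\d (t ^- j)%g) (rho g (P v)))).
    have := translates_commute j txy gid hid.
    move=> /(congr1 (fun q => rho q (P v))); rewrite !repM.
    by rewrite KP.
  rewrite -rep_adjoint c rep_adjoint -hier_of_autV KP rep_adjoint.
  by rewrite rep_adjoint -hier_of_autV invgK.
have Pdouble g k1 k2 v : P (rho (\d k1 * g * \d k2)%g (P v)) = P (rho g (P v)).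
  by rewrite !repM KP PK.
exists P; split; first by split.
split=> // [v vK|g h v]; first exact: Pfix.
have [xy _ _] := txy.
have [k1 [k2 gid]] := hier_fixes_ball g (ltnW n1) xy.
have [l1 [l2 hid]] := hier_fixes_ball h (ltnW n1) yx.
have := comm _ _ gid hid v; by rewrite !Pdouble.
Qed.

(** The two real forms that determine [hdot] are continuous. *)
Lemma orthogonal_closed (w : H) :
  closed [set v | forall g, hdot H (rho g w) v = 0].
Proof.
move=> v vcl g.
have key w' : (forall v', (forall g, hdot H (rho g w) v' = 0) ->
  rdot w' v' = 0) ->
    rdot w' v = 0.
  move=> h; apply/eqP; rewrite -normr_eq0 eq_le normr_ge0 andbT.
  apply/ler_addgt0Pr => e e0; rewrite add0r.
  have c0 : 0 < nrm w' + 1 by rewrite ltr_wpDl ?nrm_ge0.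
  have d0 : 0 < (e / (nrm w' + 1))%:C%C by rewrite ltcR divr_gt0.
  have [v' [v'W]] := vcl _ (nbhsx_ballx v _ d0).
  rewrite -ball_normE /= normr_nrm ltcR => hv.
  have -> : rdot w' v = rdot w' (v - v') by rewrite rdotBr (h v') // subr0.
  rewrite (le_trans (rdot_norm _ _)) //; move: hv;
    rewrite ltr_pdivlMr // => /ltW.
  apply: le_trans; rewrite mulrC ler_wpM2l ?nrm_ge0 // lerDl.
  exact: ler01.
rewrite -(hdot0l v); apply: hdot_eq.
  by rewrite rdot0l; apply: key => v' /(_ g); rewrite /rdot => ->.
rewrite scaler0 rdot0l; apply: key => v' /(_ g) e.
by rewrite /rdot hdotZl e mulr0.
Qed.

(** If [P rho(g) P w] is orthogonal to [u] for all [g], then so is the orbit of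
    [w]; the vectors orthogonal to this orbit form a closed invariant subspace
    that contains [u] but not [w]. *)
Lemma irreducible_dim_le1 : (1 < n)%N -> irreducible rho ->
  dim_le1 (fixed_vectors rho (Aut_in_Hier T)).
Proof.
move=> n1 [_ irr]; apply: contrapT => ndim.
have fixedE v : fixed_vectors rho (Aut_in_Hier T) v <-> forall k,
  rho (\d k) v = v.
  by split=> [h k|h _ [k _ <-]]; [apply: h; exists k|exact: h].
have [e [eK e0]] : exists e, (forall k, rho (\d k) e = e) /\ e != 0.
  apply: contrapT => no; apply: ndim; exists 0.
    by apply/fixedE => k; rewrite linear0.
  move=> v /fixedE vK; exists 0; rewrite scale0r; apply: contrapT => /eqP v0.
  by apply: no; exists v.
have [e' [eK' ee']] : exists e', (forall k, rho (\d k) e' = e') /\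
    forall c : R[i], e' != c *: e.
  apply: contrapT => no; apply: ndim; exists e; first exact/fixedE.
  move=> v /fixedE vK; apply: contrapT => nc; apply: no; exists v; split=> // c.
  by apply/eqP => vc; apply: nc; exists c.
have [P [[Pl Pc Pa] [KP Pfix Pcomm]]] := spherical_operators n1.
have PP v : P (P v) = P v by exact: Pfix.
pose A := range (fun g v => P (rho g (P v))).
have [|||||u [w [u0 w0 Pu Pw uw]]] :=
  @commuting_reducible _ _ A P e e' _ _ _ _ _ (Pfix _ eK) (Pfix _ eK') e0 ee'.
- by move=> _ [g _ <-] a v v'; rewrite Pl linearP Pl.
- by move=> _ [g _ <-] v; rewrite (le_trans (Pc _)) // rep_nrm.
- move=> _ [g _ <-]; exists (fun v => P (rho g^-1%g (P v)));
  first by exists g^-1%g.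
  by move=> v v'; rewrite Pa rep_adjoint Pa.
- by move=> _ _ [g _ <-] [h _ <-] v; rewrite !PP Pcomm.
- by exists 1%g => //; apply/funext => v; rewrite rep1 PP.
pose W := [set v | forall g, hdot H (rho g w) v = 0].
have Wu : W u.
  move=> g; rewrite -Pu -(hdot_adjoint _ _ Pl Pa) -{1}Pw.
  by apply: (uw (fun v => P (rho g (P v)))); exists g.
have [||W0|WT] := irr W _ (@orthogonal_closed w).
- split=> [|a v v'].
    by apply/mem_set => g; rewrite hdot0r.
  move=> /set_mem Wv /set_mem Wv'; apply/mem_set => g.
  by rewrite hdotDr hdotZr Wv Wv' mulr0 addr0.
- move=> g v Wv h; rewrite -(Wv (g^-1 * h)%g) repM.
  by rewrite -(rep_unitary rho g^-1%g) repK.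
- by move: Wu; rewrite W0 => /= u00; rewrite u00 eqxx in u0.
have : W w by rewrite WT.
move=> /(_ 1%g); rewrite rep1 hdot_norm => /eqP; rewrite sqrf_eq0 normr_eq0.
by rewrite (negPf w0).
Qed.

End Spherical.

(** * Unordered sums of real numbers *)

Section UnorderedSums.
Context {R : realType} {K : choiceType}.
Local Open Scope ring_scope.
Implicit Types (a b : K -> R) (L c : R) (X Y : {fset K}).

(** Convergence along the net of finite subsets. *)
Definition sums_to a L := forall e, 0 < e -> exists X0, forall X,
  (X0 `<=` X)%fset ->
  `|\sum_(j <- X) a j - L| < e.

Lemma sums_to_unique a L L' : sums_to a L -> sums_to a L' -> L = L'.
Proof.
move=> aL aL'; apply/eqP; rewrite -subr_eq0 -normr_eq0 eq_le normr_ge0 andbT.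
apply/ler_addgt0Pr => e e0; rewrite add0r; have e2 :
  0 < e / 2 by rewrite divr_gt0.
have [X hX] := aL _ e2; have [Y hY] := aL' _ e2.
have := hX _ (fsubsetUl X Y); have := hY _ (fsubsetUr X Y).
move=> hy hx; rewrite [e]splitr (le_trans (ler_distD (\sum_(j <- (X `|`
  Y)%fset) a j) _ _)) //.
by rewrite distrC lerD //; exact: ltW.
Qed.

Lemma sums_to_lin c a b L L' : sums_to a L -> sums_to b L' ->
  sums_to (fun j => c * a j + b j) (c * L + L').
Proof.
move=> aL bL e e0; have c0 : 0 < 2 * (`|c| + 1) by rewrite mulr_gt0 ?ltr_wpDl.
have [X hX] := aL _ (divr_gt0 e0 c0).
have [Y hY] := bL _ (divr_gt0 e0 (ltr0Sn _ 1)).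
exists (X `|` Y)%fset => Z; rewrite fsubUset => /andP[/hX hx /hY hy].
rewrite big_split -mulr_sumr /= opprD addrACA -mulrBr (splitr e).
rewrite (le_lt_trans (ler_normD _ _)) // ler_ltD // normrM.
have : `|c| * `|\sum_(j <- Z) a j - L| <= (`|c| + 1) * (e / (2 * (`|c| + 1))).
  by rewrite ler_pM // ?lerDl // ltW.
have c1 : `|c| + 1 != 0 by rewrite gt_eqF // ltr_wpDl.
by have -> : (`|c| + 1) * (e / (2 * (`|c| + 1))) = e / 2 by field.
Qed.

Lemma sum_fset_mono a X Y : (forall j, 0 <= a j) -> (X `<=` Y)%fset ->
  \sum_(j <- X) a j <= \sum_(j <- Y) a j.
Proof.
move=> a0 XY; rewrite (big_fsetID _ (mem X) Y) /= -[leLHS]addr0 lerD ?sumr_ge0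
  //.
rewrite le_eqVlt; apply/orP; left; apply/eqP; apply: eq_fbigl => j.
by rewrite !inE /=; have [/(fsubsetP XY) ->|] := boolP (j \in X);
  rewrite ?andbF.
Qed.

Lemma sums_to_ge a L X : (forall j, 0 <= a j) -> sums_to a L ->
  \sum_(j <- X) a j <= L.
Proof.
move=> a0 aL; apply/ler_addgt0Pr => e /aL[Y hY].
have := hY _ (fsubsetUr X Y); rewrite ltr_distl => /andP[_ /ltW].
by apply: le_trans; apply: sum_fset_mono (fsubsetUl X Y).
Qed.

Lemma sums_to_le a L c : sums_to a L -> (forall X,
  \sum_(j <- X) a j <= c) -> L <= c.
Proof.
move=> aL ac; apply/ler_addgt0Pr => e /aL[Y /(_ _ (fsubset_refl Y))].
rewrite ltr_distl => /andP[h _]; have := ac Y; lra.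
Qed.

Lemma sums_to_ge0 a c : (forall j, 0 <= a j) -> (forall X,
  \sum_(j <- X) a j <= c) ->
  exists L, sums_to a L.
Proof.
move=> a0 ac; pose A := range (fun X => \sum_(j <- X) a j).
have hA : has_sup A.
  by split; [exists (\sum_(j <- fset0%fset) a j), fset0%fset|exists c =>
    _ [X _ <-]].
exists (sup A) => e e0; have [_ [X _ <-] hX] := sup_adherent e0 hA.
exists X => Y /(sum_fset_mono a0) XY.
have : \sum_(j <- Y) a j <= sup A by apply: sup_upper_bound => //; exists Y.
by rewrite ltr_norml; lra.
Qed.

Lemma sums_to_abs a c : (forall X, \sum_(j <- X) `|a j| <= c) -> exists L,
  sums_to a L.
Proof.
move=> ac; have [||P hP] := @sums_to_ge0 (fun j => `|a j| + a j) (c + c).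
- by move=> j; rewrite -lerBlDl sub0r lerNnormlW.
- move=> X; rewrite big_split lerD // (le_trans _ (ac X)) //.
  by apply: ler_sum => j _; exact: ler_norm.
have [||Q hQ] := @sums_to_ge0 (fun j => `|a j|) c; [by []|by []|].
exists (-1 * Q + P); have := sums_to_lin (-1) hQ hP; congr sums_to.
by apply/funext => j; ring.
Qed.

Lemma sums_to_reindex a L (s s' : K -> K) : cancel s s' -> cancel s' s ->
  sums_to a L -> sums_to (a \o s) L.
Proof.
move=> ss' s's aL e /aL[X0 hX0]; exists [fset s' j | j in X0]%fset => X sX.
have -> : \sum_(j <- X) (a \o s) j = \sum_(j <- [fset s j | j in X]%fset) a j.
  by rewrite big_imfset // => i j _ _ /(can_inj ss').
apply: hX0; apply/fsubsetP => j jX; apply/imfsetP; exists (s' j);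
  last by rewrite s's.
by apply: (fsubsetP sX); rewrite in_imfset.
Qed.

Definition usum a : R := xget 0 [set L | sums_to a L].

Lemma usumE a L : sums_to a L -> usum a = L.
Proof.
move=> aL; rewrite /usum; case: xgetP => [L' _ /sums_to_unique|/(_ L)//].
exact.
Qed.

End UnorderedSums.

(** * Square-summable families *)

Section SquareSummable.
Context {R : realType} {I : choiceType}.
Local Open Scope ring_scope.
Implicit Types (f g h : I -> R[i]) (j : I * bool).

(** With two real coordinates for each entry, all the sums are sums of reals. *)
Definition coord f j : R :=
  if j.2 then complex.Im (f j.1) else complex.Re (f j.1).
Definition flip j : I * bool := (j.1, ~~ j.2).

Lemma flipK : involutive flip. Proof. by case=> i b; rewrite /flip /= negbK.
Qed.

Definition square_summable f : Prop :=
  exists c, forall X : {fset I * bool}, \sum_(j <- X) coord f j ^+ 2 <= c.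

Lemma coordP (a : R[i]) f g j : coord (a *: f + g) j =
  complex.Re a * coord f j
  + (-1) ^+ (~~ j.2) * complex.Im a * coord f (flip j) + coord g j.
Proof.
rewrite /coord /flip; have -> : (a *: f + g) j.1 = a * f j.1 + g j.1 by [].
by case: j => i [] /=; case: a (f i) (g i) => [p q] [r s] [t u] /=; ring.
Qed.

Lemma coord_i f j : coord ('i%C *: f) j = (-1) ^+ (~~ j.2) * coord f (flip j).
Proof.
have c0 : coord 0 j = 0 by case: j => ? [].
by rewrite -[_ *: f]addr0 coordP c0 /= mul0r add0r mulr1 addr0.
Qed.

Lemma coord_ext f g : coord f =1 coord g -> f = g.
Proof.
move=> fg; apply/funext => i; have := fg (i, true); have := fg (i, false).
by rewrite /coord /=; case: (f i) (g i) => [? ?] [? ?] /= -> ->.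
Qed.

Lemma sum_flip (F : I * bool -> R) (X : {fset I * bool}) :
  \sum_(j <- X) F (flip j) = \sum_(j <- [fset flip j | j in X]%fset) F j.
Proof. by rewrite big_imfset // => ? ? _ _ /(can_inj flipK). Qed.

Lemma square_summable_lin (a : R[i]) f g : square_summable f ->
  square_summable g -> square_summable (a *: f + g).
Proof.
move=> [c fc] [d gd]; pose p := 3 * complex.Re a ^+ 2; pose q :=
  3 * complex.Im a ^+ 2.
exists (p * c + q * c + 3 * d) => X.
have : \sum_(j <- X) coord (a *: f + g) j ^+ 2 <= \sum_(j <- X)
    (p * coord f j ^+ 2 + q * coord f (flip j) ^+ 2 + 3 * coord g j ^+ 2).
  have key (u v w : R) : (u + v + w) ^+ 2 <= 3 * u ^+ 2 + 3 * v ^+ 2 + 3 * w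
    ^+ 2.
    by have := sqr_ge0 (u - v); have := sqr_ge0 (u - w); have :=
      sqr_ge0 (v - w); nra.
  apply: ler_sum => j _; rewrite coordP (le_trans (key _ _ _)) //.
  by rewrite !exprMn sqrr_sign mul1r !mulrA.
move=> /le_trans; apply.
rewrite !big_split /= -!mulr_sumr (sum_flip (fun j => coord f j ^+ 2)).
have p0 : 0 <= p by rewrite mulr_ge0 ?sqr_ge0.
have q0 : 0 <= q by rewrite mulr_ge0 ?sqr_ge0.
by rewrite !lerD // ler_wpM2l.
Qed.

Definition l2_pred : {pred I -> R[i]} := fun f => `[< square_summable f >].

Lemma l2_submod_closed : submod_closed l2_pred.
Proof.
split=> [|a f g]; last first.
  by rewrite !unfold_in => /asboolP ff /asboolP gg;
    exact/asboolP/square_summable_lin.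
rewrite unfold_in; apply/asboolP; exists 0 => X; rewrite big1 // => -[i b] _.
by rewrite /coord /=; case: b; rewrite expr0n.
Qed.

HB.instance Definition _ :=
  GRing.isSubmodClosed.Build R[i] (I -> R[i]) l2_pred l2_submod_closed.

Record l2 := L2 { l2_val :> I -> R[i]; l2_valP : l2_val \in l2_pred }.
HB.instance Definition _ := [isSub for l2_val].
HB.instance Definition _ := [Choice of l2 by <:].
HB.instance Definition _ := [SubChoice_isSubLmodule of l2 by <:].

End SquareSummable.
Arguments l2 : clear implicits.

Section L2Form.
Context {R : realType} {I : choiceType}.
Local Open Scope ring_scope.
Implicit Types (f g h : l2 R I) (c : R) (j : I * bool).

Lemma l2_summable f : square_summable f.
Proof. by apply/asboolP; exact: (l2_valP f). Qed.

Lemma l2_ext f g : f =1 g -> f = g.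
Proof. by move=> fg; apply/val_inj/funext. Qed.

Lemma l2_linE (a : R[i]) f g : l2_val (a *: f + g) = a *: l2_val f + l2_val g.
Proof. by []. Qed.

Definition ip f g : R := usum (fun j => coord f j * coord g j).

Lemma ip_sums f g : sums_to (fun j => coord f j * coord g j) (ip f g).
Proof.
have [[c fc] [d gd]] := (l2_summable f, l2_summable g).
have [X|L hL] := @sums_to_abs _ _ (fun j => coord f j * coord g j) (c + d).
  rewrite (le_trans _ (lerD (fc X) (gd X))) // -big_split ler_sum // => j _ /=.
  rewrite normrM -(real_normK (num_real (coord f j))).
  rewrite -(real_normK (num_real (coord g j))).
  have := normr_ge0 (coord f j); have := normr_ge0 (coord g j); nra.
by rewrite /ip (usumE hL).
Qed.

Lemma ipC f g : ip f g = ip g f.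
Proof. by rewrite /ip; congr usum; apply/funext => j; rewrite mulrC. Qed.

Lemma ip_lin c f g h : ip (c%:C%C *: f + g) h = c * ip f h + ip g h.
Proof.
apply: usumE; have := sums_to_lin c (ip_sums f h) (ip_sums g h).
congr sums_to; apply/funext => j.
by rewrite l2_linE coordP /= mulr0 mul0r addr0 mulrDl mulrA.
Qed.

Lemma ip_ii f g : ip ('i%C *: f) ('i%C *: g) = ip f g.
Proof.
apply: usumE; have := sums_to_reindex flipK flipK (ip_sums f g).
congr sums_to; apply/funext => j.
by rewrite !coord_i mulrACA -expr2 sqrr_sign mul1r.
Qed.

Lemma ip_ge0 f : 0 <= ip f f.
Proof.
have := sums_to_ge fset0 _ (ip_sums f f).
by rewrite big_seq_fset0; apply => j; rewrite -expr2 sqr_ge0.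
Qed.

Lemma coord_le f j : coord f j ^+ 2 <= ip f f.
Proof.
have := sums_to_ge [fset j]%fset _ (ip_sums f f).
by rewrite big_seq_fset1 -expr2; apply => k; rewrite -expr2 sqr_ge0.
Qed.

Lemma ip_eq0 f : ip f f = 0 -> f = 0.
Proof.
move=> f0; apply/val_inj/coord_ext => j; have := coord_le f j; rewrite f0.
have -> : coord (\val (0 : l2 R I)) j = 0 by case: j => ? [].
by move=> h; apply/eqP; rewrite -sqrf_eq0 eq_le h sqr_ge0.
Qed.

Lemma ipD f g h : ip (f + g) h = ip f h + ip g h.
Proof. by rewrite -[f]scale1r (ip_lin 1) mul1r scale1r. Qed.

Lemma ipZ c f h : ip (c%:C%C *: f) h = c * ip f h.
Proof.
have i0 : ip 0 h = 0 by have := ipD 0 0 h; rewrite addr0; lra.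
by rewrite -[_ *: f]addr0 ip_lin i0 addr0.
Qed.

Lemma ip_skew f g : ip ('i%C *: f) g = - ip ('i%C *: g) f.
Proof.
rewrite -[LHS]ip_ii scalerA -expr2 sqr_i ipC.
have -> : (-1 : R[i]) = (-1)%:C%C by rewrite rmorphN1.
by rewrite ipC ipZ mulN1r ipC.
Qed.

(** The imaginary part is forced: [Im <f, g> = - Re <i f, g>]. *)
Definition l2_dot f g : R[i] := (ip f g +i* - ip ('i%C *: f) g)%C.

Lemma l2_dotC f g : l2_dot f g = (-1) ^+ false * Num.conj (l2_dot g f).
Proof.
rewrite expr0 mul1r -[Num.conj _]/(conjc _) /l2_dot /= opprK.
by rewrite (ipC f) ip_skew opprK.
Qed.

Lemma l2_dot_linear h : GRing.linear_for *%R (l2_dot^~ h).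
Proof.
move=> a f g; rewrite /l2_dot.
have key f' g' : ip (a *: f' + g') h =
    complex.Re a * ip f' h + complex.Im a * ip ('i%C *: f') h + ip g' h.
  have -> : a *: f' = (complex.Re a)%:C%C *: f' + (complex.Im a)%:C%C *:
    ('i%C *: f').
    by rewrite scalerA -scalerDl mulrC -complexE.
  by rewrite !ipD !ipZ.
rewrite key scalerDr scalerA (mulrC 'i%C a) -scalerA key scalerA -expr2 sqr_i.
have -> : (-1 : R[i]) = (-1)%:C%C by rewrite rmorphN1.
rewrite ipZ; case: a key => p q key /=; apply/eqP; rewrite eq_complex /=.
by apply/andP; split; apply/eqP; ring.
Qed.

Lemma l2_dot_antilinear f : GRing.linear_for (Num.conj \; *%R) (l2_dot f).
Proof.
move=> a g h; rewrite [LHS]l2_dotC l2_dot_linear (l2_dotC f g) (l2_dotC f h).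
by rewrite !expr0 !mul1r rmorphD rmorphM.
Qed.

HB.instance Definition _ := @bilinear_isBilinear.Build R[i] (l2 R I) (l2 R I)
  R[i]
  *%R (Num.conj \; *%R) l2_dot (l2_dot_linear, l2_dot_antilinear).
HB.instance Definition _ := @isHermitianSesquilinear.Build R[i] (l2 R I) false
  Num.conj l2_dot l2_dotC.

Lemma l2_dotxx f : l2_dot f f = (ip f f)%:C%C.
Proof.
have : ip ('i%C *: f) f = 0 by have := ip_skew f f; lra.
by rewrite /l2_dot => ->; rewrite oppr0.
Qed.

Lemma l2_dot_gt0 f : f != 0 -> 0 < l2_dot f f.
Proof.
move=> f0; rewrite l2_dotxx ltcR lt_def ip_ge0 andbT.
by apply: contraNneq f0 => /ip_eq0 ->.
Qed.

HB.instance Definition _ := @isDotProduct.Build R[i] (l2 R I) l2_dot l2_dot_gt0.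

Definition l2_norm f : R := Num.sqrt (ip f f).

Lemma l2_norm_sqr f : l2_norm f ^+ 2 = ip f f.
Proof. by rewrite sqr_sqrtr ?ip_ge0. Qed.

Lemma ip_le f g : ip f g <= l2_norm f * l2_norm g.
Proof.
have [->|g0] := eqVneq g 0.
  have : ip 0 f = 0 by have := ipD 0 0 f; rewrite addr0; lra.
  by rewrite ipC => ->; rewrite mulr_ge0 ?sqrtr_ge0.
have pg : 0 < ip g g.
  by rewrite lt_def ip_ge0 andbT; apply: contraNneq g0 => /ip_eq0 ->.
rewrite -sqrtrM ?ip_ge0 // (le_trans (ler_norm _)) // -sqrtr_sqr ler_wsqrtr //.
have := ip_ge0 ((ip g g)%:C%C *: f + (- ip f g)%:C%C *: g).
rewrite ipD !ipZ !(ipC _ (_ + _)) !ipD !ipZ (ipC g f) => h.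
rewrite -(ler_pM2l pg); nra.
Qed.

Lemma l2_normD f g : l2_norm (f + g) <= l2_norm f + l2_norm g.
Proof.
rewrite -(@ler_pXn2r _ 2) ?nnegrE ?addr_ge0 ?sqrtr_ge0 // l2_norm_sqr.
rewrite ipD !(ipC _ (f + g)) !ipD sqrrD !l2_norm_sqr (ipC g f).
by have := ip_le f g; lra.
Qed.

Lemma l2_normZ (a : R[i]) f : (l2_norm (a *: f))%:C%C = `|a| * (l2_norm f)%:C%C.
Proof.
have ra : `|a| = (complex.Re `|a|)%:C%C by rewrite RRe_real // ger0_real.
have a0 : 0 <= complex.Re `|a| by rewrite -ler0c -ra.
rewrite ra -rmorphM /=; congr real_complex_def; apply/eqP.
rewrite -(@eqrXn2 _ 2) ?mulr_ge0 ?sqrtr_ge0 // exprMn !l2_norm_sqr.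
apply/eqP/(@complexI R); rewrite rmorphM rmorphXn /= -ra -!l2_dotxx.
by rewrite linearZl_LR linearZr_LR /= mulrA -normCK.
Qed.

Lemma l2_norm_eq0 f : (l2_norm f)%:C%C = 0 :> R[i] -> f = 0.
Proof.
move=> /(@complexI R) nf; apply: ip_eq0.
by rewrite -l2_norm_sqr nf expr0n.
Qed.

Lemma l2_normcD f g :
  (l2_norm (f + g))%:C%C <= (l2_norm f)%:C%C + (l2_norm g)%:C%C :> R[i].
Proof. by rewrite -rmorphD lecR l2_normD. Qed.

HB.instance Definition _ := @Lmodule_isNormed.Build R[i] (l2 R I)
  (fun f => (l2_norm f)%:C%C) l2_normcD l2_normZ l2_norm_eq0.

End L2Form.

(** * The Hilbert space of square-summable families *)

Section L2Hilbert.
Context {R : realType} {I : choiceType}.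
Local Open Scope ring_scope.
Implicit Types (f g h : l2 R I) (j : I * bool) (e : R).

Lemma l2_normE f : `|f| = (l2_norm f)%:C%C. Proof. by []. Qed.

Lemma coordB (f g : I -> R[i]) j : coord (f - g) j = coord f j - coord g j.
Proof.
rewrite /coord; have -> : (f - g) j.1 = f j.1 - g j.1 by [].
by case: (f j.1) (g j.1) => [p q] [r s]; case: j.2.
Qed.

Lemma coord_dist f g j : `|coord f j - coord g j| <= l2_norm (f - g).
Proof.
have := coord_le (f - g) j; rewrite -l2_norm_sqr coordB -real_normK ?num_real
  //.
by rewrite ler_pXn2r ?nnegrE ?sqrtr_ge0.
Qed.

Lemma l2_norm_le f c : 0 <= c ->
  (forall X : {fset I * bool}, \sum_(j <- X) coord f j ^+ 2 <= c ^+ 2) ->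
    l2_norm f <= c.
Proof.
move=> c0 fc; rewrite -(@ler_pXn2r _ 2) ?nnegrE ?sqrtr_ge0 // l2_norm_sqr.
by apply: sums_to_le (ip_sums f f) _ => X; exact: fc.
Qed.

Lemma sum_coord_le f (X : {fset I * bool}) :
  \sum_(j <- X) coord f j ^+ 2 <= l2_norm f ^+ 2.
Proof.
rewrite l2_norm_sqr; have := sums_to_ge X _ (ip_sums f f).
by apply => j; rewrite -expr2 sqr_ge0.
Qed.

(** The limit is taken coordinate by coordinate.  Bounds on finite sets of
    coordinates are uniform along the filter, so they pass to this limit. *)
Lemma l2_complete (F : set_system (l2 R I)) :
  ProperFilter F -> cauchy F -> cvg F.
Proof.
move=> FF cF.
have cFe e : 0 < e -> exists2 A, F A & forall g h, A g -> A h ->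
  l2_norm (g - h) < e.
  move=> e0; have e0' : 0 < e%:C%C :> R[i] by rewrite ltcR.
  have [[A B] [/= FA FB] AB] := (cauchy_ballP F).2 cF _ e0'.
  exists (A `&` B) => [|g h [Ag _] [_ Bh]]; first exact: filterI.
  by have := AB (g, h) (conj Ag Bh); rewrite -ball_normE /= l2_normE ltcR.
have [phi phiP] : exists phi : I * bool -> R, forall j e, 0 < e ->
    F [set h : l2 R I | `|coord h j - phi j| < e].
  suff /choice[phi hphi] : forall j, exists l : R, forall e, 0 < e ->
      F [set h : l2 R I | `|coord h j - l| < e] by exists phi.
  move=> j; pose G := (fun h : l2 R I => coord h j) @ F.
  have cG : cauchy G.
    apply/cauchy_ballP => e e0; have [A FA hA] := cFe e e0.
    have GA : G [set coord g j | g in A].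
      by apply: (@filterS _ F _ A) FA => g Ag; exists g.
    exists ([set coord g j | g in A], [set coord g j | g in A]) => //.
    move=> [_ _] [/= [g Ag <-] [h Ah <-]]; rewrite -ball_normE /=.
    by rewrite (le_lt_trans (coord_dist g h j)) ?hA.
  have /cvg_ex[l Gl] : cvg G by exact: cauchy_cvg.
  exists l => e e0; have /cvgrPdist_lt/(_ e e0) := Gl.
  by apply: filterS => h /=; rewrite distrC.
pose f0 i := (phi (i, false) +i* phi (i, true))%C.
have cf0 j : coord f0 j = phi j by case: j => i [].
have near_phi (X : {fset I * bool}) e : 0 < e ->
    F [set h : l2 R I | forall j, j \in X -> `|coord h j - phi j| < e].
  move=> e0; have := @filter_bigI _ _ X (fun j => [set h :
    l2 R I | `|coord h j - phi j| < e]) F FF.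
  by move=> /(_ (fun j _ => phiP j e e0)); apply: filterS => h hX j /hX.
have close e : 0 < e -> exists2 A, F A & forall g, A g ->
    forall X : {fset I * bool}, \sum_(j <- X) (coord g j - phi j) ^+ 2 <= (2 *
      e) ^+ 2.
  move=> e0; have [A FA hA] := cFe e e0; exists A => // g Ag X.
  pose N : R := (size (X : seq _)).+1%:R; have N0 : 0 < N by rewrite ltr0n.
  (* [d^2 <= d], and adding up [d] over [X] gives at most [e^2] *)
  pose d := Num.min 1 (e ^+ 2 / N).
  have d0 : 0 < d by rewrite lt_min ltr01 divr_gt0 // exprn_gt0.
  have [h [Ah hh]] := filter_ex (filterI FA (near_phi X d d0)).
  have : \sum_(j <- X) (coord g j - phi j) ^+ 2 <=
      \sum_(j <- X) (2 * coord (g - h : l2 R I) j ^+ 2) + \sum_(j <- X) (2 * d).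
    rewrite -big_split big_seq [leRHS]big_seq ler_sum // => j /hh.
    rewrite coordB /= ltr_distl => /andP[h1 h2].
    have d1 : d <= 1 by rewrite ge_min lexx.
    set p := coord g j; set q := coord h j in h1 h2 *; set r :=
      phi j in h1 h2 *.
    have : (p - r) ^+ 2 <= 2 * (p - q) ^+ 2 + 2 * (q - r) ^+ 2.
      by have := sqr_ge0 (p - q - (q - r)); nra.
    have : (q - r) ^+ 2 <= d by nra.
    by nra.
  move=> /le_trans; apply; rewrite -mulr_sumr big_const_seq count_predT
    iter_addr addr0.
  have := sum_coord_le (g - h) X.
  have gh := hA g h Ag Ah; have := sqrtr_ge0 (ip (g - h) (g - h)).
  rewrite -/(l2_norm _) => gh0 hs.
  have : (2 * d) *+ size (X : seq _) <= 2 * e ^+ 2.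
    have dN : d * N <= e ^+ 2 by rewrite -ler_pdivlMr // ge_min lexx orbT.
    rewrite -mulr_natr -mulrA ler_pM2l // (le_trans _ dN) // ler_pM2l //.
    by rewrite ler_nat.
  nra.
have f0s : f0 \in l2_pred.
  apply/asboolP; have [A FA hA] := close 1 ltr01.
  have [g Ag] := filter_ex FA; exists (2 * (2 * 1) ^+ 2 + 2 * l2_norm g ^+ 2)
    => X.
  have : \sum_(j <- X) coord f0 j ^+ 2 <= \sum_(j <- X)
      (2 * (coord g j - phi j) ^+ 2 + 2 * coord g j ^+ 2).
    apply: ler_sum => j _; rewrite cf0.
    by have := sqr_ge0 (2 * coord g j - phi j); nra.
  move=> /le_trans; apply; rewrite big_split -!mulr_sumr /= lerD // ler_pM2l //.
    exact: hA.
  exact: sum_coord_le.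
pose f : l2 R I := L2 f0s.
apply/cvg_ex; exists f; apply/cvgrPdist_le => e e0.
have re : e = (complex.Re e)%:C%C by rewrite RRe_real // gtr0_real.
have e0' : 0 < complex.Re e / 2 by rewrite divr_gt0 // -ltcR -re.
have [A FA hA] := close _ e0'; apply: filterS FA => g /hA hg.
rewrite /= distrC l2_normE re lecR; apply: l2_norm_le.
  by rewrite -lecR -re ltW.
move=> X; have := hg X; rewrite mulrCA mulfV ?mulr1 ?pnatr_eq0 //; apply:
  le_trans.
by rewrite le_eqVlt; apply/orP; left; apply/eqP/eq_bigr => j _;
  rewrite coordB cf0.
Qed.

HB.instance Definition _ := @Uniform_isComplete.Build (l2 R I) l2_complete.

Lemma l2_hdot_norm f : l2_dot f f = `|f| ^+ 2.
Proof. by rewrite l2_normE -rmorphXn /= l2_norm_sqr l2_dotxx. Qed.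

Definition l2_hilbert : hilbert_space R :=
  @HilbertSpace R (l2 R I : completeNormedModType R[i]) (l2_dot :
    Dot.type _ _) l2_hdot_norm.

End L2Hilbert.
Arguments l2_hilbert : clear implicits.

(** * Permutation representations and cosets of stabilizers *)

Section PermutationRepresentation.
Context {R : realType} {G : preTopologicalGroupType} {I : choiceType}.
Local Open Scope ring_scope.
Variable act : G -> I -> I.
Hypotheses (act1 : forall i, act 1%g i = i)
  (actM : forall g h i, act (g * h)%g i = act g (act h i))
  (act_cont : forall g0 i, nbhs g0 [set g | act g i = act g0 i]).
Implicit Types (f : l2 R I) (g h : G) (i : I) (e : R).

Let actK g : cancel (act g) (act g^-1%g).
Proof. by move=> i; rewrite -actM mulVg act1. Qed.

Let actVK g : cancel (act g^-1%g) (act g).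
Proof. by move=> i; rewrite -actM mulgV act1. Qed.

Let act2 g (j : I * bool) := (act g j.1, j.2).

Let act2K g : cancel (act2 g) (act2 g^-1%g).
Proof. by case=> i b; rewrite /act2 /= actK. Qed.

Let act2VK g : cancel (act2 g^-1%g) (act2 g).
Proof. by case=> i b; rewrite /act2 /= actVK. Qed.

Let translate_subproof g f : (f \o act g^-1%g) \in l2_pred.
Proof.
apply/asboolP; have [c fc] := l2_summable f; exists c => X.
rewrite -[X in _ <= X]/c; have := fc [fset act2 g^-1%g j | j in X]%fset.
by rewrite big_imfset //= => ? ? _ _ /(can_inj (act2VK g)).
Qed.

Definition translate g f : l2 R I := L2 (translate_subproof g f).

Let translate_linear g : linear (translate g).
Proof. by move=> a f f'; apply: l2_ext. Qed.

HB.instance Definition _ g :=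
  GRing.isLinear.Build R[i] (l2 R I) (l2 R I) *:%R (translate g)
    (translate_linear g).

Let translate1 f : translate 1%g f = f.
Proof. by apply: l2_ext => i; rewrite /= invg1 act1. Qed.

Let translateM g h f : translate (g * h)%g f = translate g (translate h f).
Proof. by apply: l2_ext => i; rewrite /= invgM actM. Qed.

Let ip_translate g f f' : ip (translate g f) (translate g f') = ip f f'.
Proof.
apply: usumE; have := sums_to_reindex (act2VK g) (act2K g) (ip_sums f f').
by congr sums_to.
Qed.

Let translate_unitary g f f' :
  l2_dot (translate g f) (translate g f') = l2_dot f f'.
Proof. by rewrite /l2_dot -linearZ !ip_translate. Qed.

Let norm_translate g f : l2_norm (translate g f) = l2_norm f.
Proof. by rewrite /l2_norm ip_translate. Qed.

Lemma l2_finite_support f e : 0 < e -> exists (X : {fset I}) (f' : l2 R I),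
  (forall i, i \notin X -> f' i = 0) /\ l2_norm (f - f') < e.
Proof.
move=> e0; have d0 : 0 < e ^+ 2 / 8 by rewrite divr_gt0 // exprn_gt0.
have [X0 hX0] := ip_sums f f d0.
pose X := [fset j.1 | j in X0]%fset.
pose f0 i := if i \in X then f i else 0.
have cf0 j : coord f0 j = if j.1 \in X then coord f j else 0.
  by rewrite /coord /f0; case: (j.1 \in X); case: j.2.
have f0s : f0 \in l2_pred.
  apply/asboolP; have [c fc] := l2_summable f; exists c => Y.
  apply: le_trans (fc Y); apply: ler_sum => j _; rewrite cf0.
  by case: ifP => // _; rewrite expr0n sqr_ge0.
exists X, (L2 f0s); split=> [i /negPf iX|]; first by rewrite /= /f0 iX.
have e2 : e / 2 < e by lra.
apply: le_lt_trans e2; apply: l2_norm_le => [|Y];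
  first by rewrite divr_ge0 // ltW.
pose Y' := [fset j in Y | j.1 \notin X]%fset.
have -> : \sum_(j <- Y) coord (f - L2 f0s : l2 R I) j ^+ 2 =
    \sum_(j <- Y') coord f j * coord f j.
  rewrite big_fset /= [RHS]big_mkcond /=; apply: eq_bigr => j _.
  rewrite coordB /= cf0; case: ifP => _ /=; first by rewrite subrr expr0n.
  by rewrite subr0 expr2.
(* both sums are within [e^2 / 8] of the total, and they differ by the sum over
   [Y'] *)
have := hX0 _ (fsubset_refl X0); have := hX0 _ (fsubsetUl X0 Y').
have -> : \sum_(j <- (X0 `|` Y')%fset) coord f j * coord f j =
    \sum_(j <- X0) coord f j * coord f j + \sum_(j <- Y') coord f j * coord f j.
  rewrite (big_fsetID _ (mem X0)) /=; congr (_ + _); apply: eq_fbigl => j.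
    by rewrite !inE /=; case: (j \in X0); rewrite ?andbF.
  rewrite !inE /=; have [jX0|] := boolP (j \in X0); rewrite /= ?andbT //.
  apply/esym/negbTE; rewrite negb_and negbK; apply/orP; right.
  by apply/imfsetP; exists j.
rewrite !ltr_norml; nra.
Qed.

(** Translation is locally constant on finitely supported families, which are
    dense, and it is isometric. *)
Let translate_continuous f : continuous (translate^~ f).
Proof.
move=> g0; apply/cvgrPdist_lt => e e0.
have re : e = (complex.Re e)%:C%C by rewrite RRe_real // gtr0_real.
have e0' : 0 < complex.Re e / 2 by rewrite divr_gt0 // -ltcR -re.
have [X [f' [f'X ff']]] := l2_finite_support f e0'.
have : nbhs g0 (\bigcap_(i in [set` X]) [set g | act g i = act g0 i]).
  by apply: filter_bigI => i _; exact: act_cont.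
apply: filterS => g hg; rewrite /= l2_normE re ltcR.
have e1 : translate g0 f' = translate g f'.
  have key h h' i : (forall i, i \in X -> act h i = act h' i) ->
      act h^-1%g i \in X -> act h^-1%g i = act h'^-1%g i.
    by move=> hh' /hh' e1; rewrite actVK in e1; rewrite {2}e1 actK.
  apply: l2_ext => i /=; have [iX|niX] := boolP (act g^-1%g i \in X).
    by rewrite (key g g0 i) // => k kX; exact: hg.
  have [iX|niX'] := boolP (act g0^-1%g i \in X); last by rewrite !f'X.
  by rewrite (key g0 g i) // => k kX; apply/esym/hg.
have -> : translate g0 f - translate g f =
    translate g0 (f - f') + - translate g (f - f').
  have lB h : translate h (f - f') = translate h f - translate h f'.
    exact: linearB.
  by rewrite !lB e1 opprB addrA subrK.
rewrite (le_lt_trans (l2_normD _ _)) //.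
have -> : l2_norm (- translate g (f - f')) = l2_norm (f - f').
  by rewrite -linearN /= norm_translate; apply: (@complexI R);
    rewrite -!l2_normE normrN.
by rewrite norm_translate; lra.
Qed.

Definition permutation_rep : unitary_rep G (l2_hilbert R I) :=
  @UnitaryRep R G (l2_hilbert R I) (fun g => translate g :
    {linear l2 R I -> l2 R I})
    translate1 translateM translate_unitary translate_continuous.

Let delta_subproof i : (fun k => (k == i)%:R : R[i]) \in l2_pred.
Proof.
apply/asboolP; exists 1 => X.
have c0 j : j != (i, false) -> coord (fun k => (k == i)%:R : R[i]) j ^+ 2 = 0.
  case: j => k b; rewrite xpair_eqE /coord /=.
  by case: (k == i); case: b => //= _; rewrite expr0n.
have [iX|iX] := boolP ((i, false) \in X).
  rewrite (big_fsetD1 (i, false)) //= [X in _ + X]big1_seq ?addr0.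
    by rewrite /coord /= eqxx expr1n.
  by move=> j; rewrite !inE => /andP[_ /andP[ji _]]; exact: c0.
by rewrite big1_seq ?ler01 // => j /andP[_ jX]; apply: c0; apply:
  contraNneq iX => <-.
Qed.

Definition delta i : l2 R I := L2 (delta_subproof i).

Lemma permutation_rep_delta g i : permutation_rep g (delta i) = delta (act g i).
Proof.
apply: l2_ext => k /=; have -> // : (act g^-1%g k == i) = (k == act g i).
by apply/eqP/eqP => [<-|->]; rewrite ?actVK ?actK.
Qed.

Lemma delta_inj : injective delta.
Proof.
move=> i k /(congr1 (fun f : l2 R I => f i)) /=; rewrite eqxx; case:
  eqP => // _ /eqP.
by rewrite oner_eq0.
Qed.

End PermutationRepresentation.

Section Cosets.
Context {n : nat} {T : regular_tree n}.
Implicit Types (F : set T) (g h q : hier T) (k m : aut T).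

Definition coset_of_stabilizer q F : set (hier T) :=
  [set (q * \d k)%g | k in stabilizer F].

Definition is_coset : set (set (hier T)) :=
  [set A | exists q F, finite_set F /\ A = coset_of_stabilizer q F].

(** The empty [F] gives the cosets of the automorphism group; the others are
    there to make the action faithful. *)
Definition coset : Type := set_type is_coset.
HB.instance Definition _ := Choice.on coset.

Lemma left_translate_coset g q F :
  [set (g * a)%g | a in coset_of_stabilizer q F] = coset_of_stabilizer (g *
    q)%g F.
Proof.
apply/seteqP; split=> [_ [_ [k kF <-] <-]|_ [k kF <-]].
  by exists k; rewrite ?mulgA.
by exists (q * \d k)%g; [exists k|rewrite mulgA].
Qed.

Lemma coset_act_subproof g (A : coset) : is_coset [set (g * a)%g | a in val A].
Proof.
have [q [F [fF ->]]] := set_mem (valP A).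
by exists (g * q)%g, F; split=> //; exact: left_translate_coset.
Qed.

Definition coset_act g (A : coset) : coset :=
  SigSub (mem_set (coset_act_subproof g A)).

Lemma coset_act1 A : coset_act 1%g A = A.
Proof.
apply/val_inj/seteqP; split=> [_ [a Aa <-]|a Aa] /=; first by rewrite mul1g.
by exists a; rewrite ?mul1g.
Qed.

Lemma coset_actM g h A : coset_act (g * h)%g A = coset_act g (coset_act h A).
Proof.
apply/val_inj/seteqP; split=> [_ [a Aa <-]|_ [_ [a Aa <-] <-]] /=.
  by exists (h * a)%g; [exists a|rewrite mulgA].
by exists a; rewrite ?mulgA.
Qed.

Lemma coset_act_continuous g0 A :
  nbhs g0 [set g | coset_act g A = coset_act g0 A].
Proof.
have [q [F [fF eA]]] := set_mem (valP A).
have [F' fF' hF'] := hier_commensurates q fF.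
apply: nbhs_hierP fF' _ => k /hF'[m mF e] /=; rewrite coset_actM;
  congr coset_act.
apply/val_inj; rewrite /= eA left_translate_coset e.
apply/seteqP; split=> _ [s sF <-].
  by exists (m * s)%g; [exact: stabilizerM|rewrite hier_of_autM mulgA].
exists (m^-1 * s)%g; first by apply: stabilizerM sF; exact: stabilizerV.
by rewrite -mulgA -hier_of_autM mulKVg.
Qed.

Definition stabilizer_as_coset F (fF : finite_set F) : coset :=
  SigSub (mem_set (ex_intro _ 1%g (ex_intro _ F (conj fF erefl)))).

Lemma coset_act_fixed g F (fF : finite_set F) :
  coset_act g (stabilizer_as_coset fF) = stabilizer_as_coset fF <->
  exists2 k, stabilizer F k & g = \d k.
Proof.
split=> [/(congr1 val) /= e|[k kF ->]].
  have : coset_of_stabilizer 1%g F g.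
    rewrite -e; exists 1%g; last exact: mulg1.
    by exists 1%g; rewrite // hier_of_aut1 mulg1.
  by move=> [k kF <-]; exists k; rewrite ?mul1g.
apply/val_inj; rewrite /= left_translate_coset mulg1.
apply/seteqP; split=> _ [s sF <-].
  by exists (k * s)%g; [exact: stabilizerM|rewrite hier_of_autM mul1g].
exists (k^-1 * s)%g; first by apply: stabilizerM sF; exact: stabilizerV.
by rewrite -hier_of_autM mulKVg mul1g.
Qed.

(** For every [N], [g] acts as an automorphism fixing [a 0] and [a N].  These
    automorphisms all send [a] to ways with the same origin and the same end,
    that is to a single way, which therefore agrees with [a] at every [N]. *)
Lemma fixing_stabilizers_trivial g :
  (forall F, finite_set F -> exists2 k, stabilizer F k & g = \d k) -> g = 1%g.
Proof.
move=> gF; apply: hier_eq => e; have [a ->] := endpoint_surj e.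
have kN N : exists k, [/\ k (a 0%N) = a 0%N, k (a N) = a N & g = \d k].
  have [|k kF ->] := gF [set a 0%N; a N]; first exact: finite_set2.
  by exists k; split=> //; apply: kF; [left|right].
have [k [k0 _ gk]] := kN 0%N; rewrite gk /= -[LHS]/(boundary_act k _).
rewrite boundary_act_endpoint; congr endpoint; apply/val_inj/funext => N.
have [m [m0 mN gm]] := kN N.
rewrite -[RHS]mN; apply: (@way_unique _ _ (way_map k a) (way_map m a)).
  by rewrite /= -[LHS]/(k (a 0%N)) -[RHS]/(m (a 0%N)) k0 m0.
rewrite -!boundary_act_endpoint.
by have := congr1 (fun h : hier T => h (endpoint a)) (etrans (esym gk) gm).
Qed.

Lemma exists_spherical_rep (R : realType) :
  exists (H : hilbert_space R) (rho : unitary_rep (hier T) H) (v : H),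
    faithful rho /\ vector_stabilizer rho v = Aut_in_Hier T.
Proof.
pose rho := @permutation_rep R _ _ coset_act coset_act1 coset_actM
  coset_act_continuous.
exists (l2_hilbert R coset), rho, (delta (stabilizer_as_coset (finite_set0 T))).
have rho_fixed g F (fF : finite_set F) :
    rho g (delta (stabilizer_as_coset fF)) = delta (stabilizer_as_coset fF) <->
    exists2 k, stabilizer F k & g = \d k.
  rewrite permutation_rep_delta; split=> [/delta_inj/coset_act_fixed//|].
  by move=> /(coset_act_fixed g fF) ->.
split=> [g gx|].
  by apply: fixing_stabilizers_trivial => F fF; apply/(rho_fixed g F fF)/gx.
apply/seteqP; split=> g; first by move=> /rho_fixed[k _ ->]; exists k.
by move=> [k _ <-]; apply/rho_fixed; exists k.
Qed.

End Cosets.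

Theorem theorem1p2 (n : nat) (hn : (2 <= n)%N) (T : regular_tree n)
    (R : realType) :
  (forall (H : hilbert_space R) (rho : unitary_rep (hier T) H),
     irreducible rho -> dim_le1 (fixed_vectors rho (Aut_in_Hier T))) /\
  (exists (H : hilbert_space R) (rho : unitary_rep (hier T) H) (v : H),
     faithful rho /\ vector_stabilizer rho v = Aut_in_Hier T).
Proof.
split; last exact: exists_spherical_rep.
by move=> H rho; exact: irreducible_dim_le1.
Qed.
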